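(* Let $\phi=\tilde p/p$ be an irreducible rational inner function on $\mathbb{D}^3$ of degree $(m,n,1)$ with $p(z)=p_1(z_1,z_2)+z_3p_2(z_1,z_2)$, $\tilde p(z)=z_3\tilde p_1(z_1,z_2)+\tilde p_2(z_1,z_2)$, and assume $\mathcal{Z}_p\cap\mathbb{T}^3$ is finite. Fix $\lambda\in\mathbb{T}$, let $q_\lambda=\lambda p_1-\tilde p_2$ and $\Psi_\lambda=\bar\lambda\,q_\lambda/\tilde q_\lambda$. Then: (A) if there is $\tau\in\mathcal{Z}_p\cap\mathbb{T}^3$ with $\phi^*(\tau)=\lambda$, then $1/\Psi_\lambda$ has a singularity at $(\tau_1,\tau_2)\in\mathbb{T}^2$; (B) if there is no $\tau\in\mathcal{Z}_p\cap\mathbb{T}^3$ with $\phi^*(\tau)=\lambda$, then $1/\Psi_\lambda$ is continuous on $\overline{\mathbb{D}^2}$.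
   Context: A rational inner function (RIF) on $\mathbb{D}^3$ is a rational function holomorphic on the tridisk with unimodular radial limits a.e. on $\mathbb{T}^3$; it is written $\phi=\tilde p/p$ with $p$ zero-free on $\mathbb{D}^3$, $p,\tilde p$ without common factors. For degree $(m,n,1)$, $\tilde p(z)=z_1^mz_2^nz_3\overline{p(1/\bar z_1,1/\bar z_2,1/\bar z_3)}$, and reflections of two-variable polynomials are taken with respect to $(m,n)$: $\tilde q(z_1,z_2)=z_1^mz_2^n\overline{q(1/\bar z_1,1/\bar z_2)}$. $\phi^*(\tau)$ is the nontangential limit of $\phi$ at $\tau\in\mathbb{T}^3$ (limit as $z\to\tau$ in $\mathbb{D}^3$ with $\|z-\tau\|\le C(1-\|z\|)$), which exists at every point. A singularity of a two-variable RIF $q_\lambda^{-1}\lambda\tilde q_\lambda$ at a point of $\mathbb{T}^2$ means a common zero of numerator and denominator there (the function is not continuous there). $\mathcal{Z}_p$ is the zero set of $p$. *)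

(* Defs.v *)
From HB Require Import structures.
From mathcomp Require Import all_boot all_order all_algebra.
From mathcomp Require Import reals complex.
From mathcomp Require Import mpoly.
Set Implicit Arguments. Unset Strict Implicit. Unset Printing Implicit Defensive.
Import Order.TTheory GRing.Theory Num.Theory.
Local Open Scope ring_scope.

Definition degv (C : nzRingType) (k : nat) (p : {mpoly C[k]}) (i : 'I_k) : nat :=
  \max_(mo <- msupp p) mo i.

Definition mnm3 (m n : nat) : 'X_{1..3} := [multinom nth 0%N [:: m; n; 1%N] i | i < 3].
Definition mnm2 (m n : nat) : 'X_{1..2} := [multinom nth 0%N [:: m; n] i | i < 2].

(* reflection with respect to the multidegree N:
   p~(z) = z^N * conj(p(1/conj z)), i.e. coefficient of z^(N - a) is conj(coeff of z^a) *)
Definition mrefl (R : rcfType) (k : nat) (N : 'X_{1..k}) (p : {mpoly R[i][k]})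
  : {mpoly R[i][k]} :=
  \sum_(mo <- msupp p) (Num.conj (p@_mo)) *: 'X_[(N - mo)%MM].

Definition ev2 (R : rcfType) (q : {mpoly R[i][2]}) (a b : R[i]) : R[i] :=
  q.@[fun j : 'I_2 => nth 0 [:: a; b] j].
Definition ev3 (R : rcfType) (p : {mpoly R[i][3]}) (a b c : R[i]) : R[i] :=
  p.@[fun j : 'I_3 => nth 0 [:: a; b; c] j].

Definition normc (R : rcfType) (z : R[i]) : R := ComplexField.Normc.normc z.

Definition inD (R : rcfType) (z : R[i]) : Prop := normc z < 1.
Definition inT (R : rcfType) (z : R[i]) : Prop := normc z = 1.
Definition inDbar (R : rcfType) (z : R[i]) : Prop := normc z <= 1.

Definition norm3 (R : rcfType) (a b c : R[i]) : R :=
  Num.max (normc a) (Num.max (normc b) (normc c)).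

Definition mconst (R : rcfType) (k : nat) (d : {mpoly R[i][k]}) : Prop :=
  exists c : R[i], d = c%:MP.
Definition mdivides (R : rcfType) (k : nat) (d p : {mpoly R[i][k]}) : Prop :=
  exists a : {mpoly R[i][k]}, p = d * a.

Definition mirreducible (R : rcfType) (k : nat) (p : {mpoly R[i][k]}) : Prop :=
  ~ mconst p /\
  forall a b : {mpoly R[i][k]}, p = a * b -> mconst a \/ mconst b.

Definition no_common_factor (R : rcfType) (k : nat) (p q : {mpoly R[i][k]}) : Prop :=
  forall d : {mpoly R[i][k]}, mdivides d p -> mdivides d q -> mconst d.

Definition ptilde (R : rcfType) (m n : nat) (p : {mpoly R[i][3]}) : {mpoly R[i][3]} :=
  mrefl (mnm3 m n) p.

Definition RIF3_deg (R : rcfType) (m n : nat) (p : {mpoly R[i][3]}) : Prop :=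
  [/\ p != 0,
      (forall a b c, inD a -> inD b -> inD c -> ev3 p a b c != 0),
      no_common_factor p (ptilde m n p),
      (forall j : 'I_3, (degv p j <= mnm3 m n j)%N) &
      (forall j : 'I_3, maxn (degv p j) (degv (ptilde m n p) j) = mnm3 m n j)].

Definition phi3 (R : rcfType) (m n : nat) (p : {mpoly R[i][3]}) (a b c : R[i]) : R[i] :=
  ev3 (ptilde m n p) a b c / ev3 p a b c.

Definition nt_limit (R : rcfType) (m n : nat) (p : {mpoly R[i][3]})
  (t1 t2 t3 : R[i]) (L : R[i]) : Prop :=
  forall K : R, 0 < K -> forall eps : R, 0 < eps -> exists2 del : R, 0 < del &
    forall a b c : R[i], inD a -> inD b -> inD c ->
      norm3 (a - t1) (b - t2) (c - t3) <= K * (1 - norm3 a b c) ->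
      norm3 (a - t1) (b - t2) (c - t3) < del ->
      normc (phi3 m n p a b c - L) < eps.

Definition cont_on_closed_bidisk (R : rcfType) (f : R[i] -> R[i] -> R[i]) : Prop :=
  forall a b : R[i], inDbar a -> inDbar b ->
    forall eps : R, 0 < eps -> exists2 del : R, 0 < del &
      forall x y : R[i], inDbar x -> inDbar y ->
        Num.max (normc (x - a)) (normc (y - b)) < del ->
        normc (f x y - f a b) < eps.

(* Main.v *)
(* Put N = p~ - lam p = z3 lam q~ - q, so that phi - lam = N / p.

   (A) If phi tends to lam nontangentially at tau, then N = o(p) along the paths
   ((1-t) tau1, (1-t) tau2, (1-rt) tau3) for r = 1, 2, while p = O(t).  Hence the linear
   part of N kills the difference of the two directions, that is, the z3-derivative
   lam q~(tau1, tau2) of N vanishes, and then so does q(tau1, tau2) since N(tau) = 0.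

   (B) Restricting p to Blaschke discs gives |p~| <= |p| on the tridisk.  In particular
   |p2~| <= |p1| on the bidisk, so q is a limit of stable polynomials, and a Harnack type
   inequality shows that q is zero free on the bidisk or identically zero; the latter would
   make p divide p~.  If q vanishes at (tau1, tau2) in T^2, then tau3 = - p1/p2 gives a zero
   tau of p on T^3 at which d/dz3 N = 0.  The inequality |N + lam p| <= |p|, applied to the
   linear parts on the tangent cone, forces the whole gradient of N to vanish, whereas
   |p| >= |p2| (1 - |z3|); so phi tends to lam nontangentially at tau, a contradiction.
   Finally a zero of q on D x T or T x D would propagate to T^2 by the Harnack inequality. *)
Require Import Defs.
From HB Require Import structures.
From mathcomp Require Import all_boot all_order all_algebra.
From mathcomp Require Import reals complex.
From mathcomp Require Import mpoly ring lra zify.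
Import Order.TTheory GRing.Theory Num.Theory.
Local Open Scope ring_scope.

Set Implicit Arguments.
Unset Strict Implicit.
Unset Printing Implicit Defensive.

(** * The modulus on R[i] *)

Section ComplexModulus.
Variable R : rcfType.
Implicit Types x y z : R[i].

Lemma normcM x y : normc (x * y) = normc x * normc y.
Proof. exact: ComplexField.Normc.normcM. Qed.

Lemma normcD x y : normc (x + y) <= normc x + normc y.
Proof. exact: (@le_normcD R x y). Qed.

Lemma normcN x : normc (- x) = normc x.
Proof. exact: (@complex.normcN R x). Qed.

Lemma normcB x y : normc (x - y) <= normc x + normc y.
Proof. by rewrite -(normcN y) normcD. Qed.

Lemma normc_distC x y : normc (x - y) = normc (y - x).
Proof. by rewrite -opprB normcN. Qed.

Lemma normcBr x y : normc x - normc y <= normc (x - y).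
Proof. by have := normcD (x - y) y; rewrite subrK lerBlDr. Qed.

Lemma normc0 : normc (0 : R[i]) = 0. Proof. exact: ComplexField.Normc.normc0. Qed.
Lemma normc1 : normc (1 : R[i]) = 1. Proof. exact: ComplexField.Normc.normc1. Qed.

Lemma normcV x : normc x^-1 = (normc x)^-1.
Proof. exact: ComplexField.Normc.normcV. Qed.

Lemma normc_ge0 x : 0 <= normc x.
Proof. by case: x => a b; exact: sqrtr_ge0. Qed.

Lemma normc_eq0 x : (normc x == 0) = (x == 0).
Proof.
by apply/eqP/eqP => [/ComplexField.Normc.eq0_normc //|->]; exact: normc0.
Qed.

Lemma normc_gt0 x : (0 < normc x) = (x != 0).
Proof. by rewrite lt_def normc_ge0 normc_eq0 andbT. Qed.

Lemma normcX x k : normc (x ^+ k) = normc x ^+ k.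
Proof. by elim: k => [|k IH]; rewrite ?normc1 // !exprS normcM IH. Qed.

Lemma normc_real (t : R) : normc t%:C%C = `|t|.
Proof. by rewrite /normc /= expr0n addr0 sqrtr_sqr. Qed.

Lemma normc_sqr (a b : R) : normc (a +i* b)%C ^+ 2 = a ^+ 2 + b ^+ 2.
Proof. by rewrite /normc /= sqr_sqrtr // addr_ge0 // sqr_ge0. Qed.

Lemma normc_conj x : normc (Num.conj x) = normc x.
Proof. by case: x => a b; rewrite /normc /= sqrrN. Qed.

Lemma mul_conjc x : Num.conj x * x = (normc x ^+ 2)%:C%C.
Proof.
case: x => a b; rewrite normc_sqr; apply/eqP.
by rewrite eq_complex /=; apply/andP; split; apply/eqP; ring.
Qed.

Lemma conj_inT x : inT x -> Num.conj x * x = 1.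
Proof. by move=> h; rewrite mul_conjc h expr1n. Qed.

Lemma inT_neq0 x : inT x -> x != 0.
Proof. by move=> h; rewrite -normc_gt0 h ltr01. Qed.

Lemma normc_le_sqr x y : (normc x <= normc y) = (normc x ^+ 2 <= normc y ^+ 2).
Proof. by rewrite ler_sqr // nnegrE normc_ge0. Qed.

Lemma normc_sum (I : Type) (s : seq I) (F : I -> R[i]) :
  normc (\sum_(i <- s) F i) <= \sum_(i <- s) normc (F i).
Proof.
elim: s => [|i s IH]; first by rewrite !big_nil normc0.
by rewrite !big_cons (le_trans (normcD _ _)) // lerD2l.
Qed.

End ComplexModulus.

(** * First order expansions of polynomials *)

(** Stands in for dividing by [t] and letting [t] tend to 0: at [t = min 1 (a / (2C))] the
    hypothesis already gives [a <= a / 2]. All limit arguments below are reduced to this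
    estimate. *)
Lemma eq0_of_quadratic_bound (R : realFieldType) (a C : R) : 0 <= a ->
  (forall t, 0 < t -> t <= 1 -> a * t <= C * t ^+ 2) -> a = 0.
Proof.
move=> a0 h; apply/eqP; rewrite eq_le a0 andbT leNgt; apply/negP => agt.
have C0 : 0 < C by have := h 1 ltr01 (lexx _); rewrite expr1n !mulr1; exact: lt_le_trans.
pose t := Num.min 1 (a / (2 * C)).
have t0 : 0 < t by rewrite lt_min ltr01 divr_gt0 // mulr_gt0.
have tC : t * (2 * C) <= a by rewrite -ler_pdivlMr ?mulr_gt0 // ge_min lexx orbT.
have /(_ _) := h t t0; rewrite ge_min lexx => /(_ isT).
by nra.
Qed.

Lemma le0_of_linear_bound (R : realFieldType) (a C : R) :
  (forall t, 0 < t -> t <= 1 -> a <= C * t) -> a <= 0.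
Proof.
move=> h; rewrite leNgt; apply/negP => agt.
suff a0 : a = 0 by rewrite a0 ltxx in agt.
apply: (@eq0_of_quadratic_bound _ _ C (ltW agt)) => t t0 t1.
by rewrite expr2 mulrA ler_wpM2r ?(ltW t0) // h.
Qed.

(** Induction along the ring operations, so that Taylor bounds follow from the Leibniz rule and need
    no expansion into monomials. *)
Lemma mpoly_closed_ind (k : nat) (K : comNzRingType) (P : {mpoly K[k]} -> Prop) :
  (forall c, P c%:MP) -> (forall i, P 'X_i) ->
  (forall f g, P f -> P g -> P (f + g)) ->
  (forall f g, P f -> P g -> P (f * g)) -> forall f, P f.
Proof.
move=> PC PX PD PM f; elim/mpolyind: f => [|c m f _ _ IH]; first exact: (PC 0).
apply: PD => //; rewrite -mul_mpolyC; apply: (PM); first exact: PC.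
rewrite mpolyXE_id; apply: big_ind => [|g h|i _]; [exact: (PC 1)|exact: (PM)|].
by elim: (m i) => [|j IHj]; [exact: (PC 1)|rewrite exprS; exact: (PM)].
Qed.

Lemma taylor_sum (K : comNzRingType) (f0 f1 df g0 g1 dg : K) :
  f1 + g1 - (f0 + g0) - (df + dg) = (f1 - f0 - df) + (g1 - g0 - dg).
Proof. by ring. Qed.

(** Each term on the right has second order: the first is a product of two linear parts, the other
    two contain a Taylor remainder. *)
Lemma taylor_product (K : comNzRingType) (f0 f1 df g0 g1 dg : K) :
  f1 * g1 - f0 * g0 - (f0 * dg + df * g0) =
  df * dg + (f0 + df + (f1 - f0 - df)) * (g1 - g0 - dg) + (f1 - f0 - df) * (g0 + dg).
Proof. by ring. Qed.

Section Taylor.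
Variable (R : rcfType) (k : nat).
Implicit Types (f g : {mpoly R[i][k]}) (x h : 'I_k -> R[i]).

Definition tangent f x h : R[i] := \sum_i f^`M(i).@[x] * h i.

(** The constant may depend on [x] but not on [h]; the restriction [M <= 1] lets higher powers of
    [M] be absorbed into [M ^+ 2]. *)
Definition taylor_at x f : Prop := exists C : R, 0 <= C /\
  forall h (M : R), 0 <= M -> M <= 1 -> (forall i, normc (h i) <= M) ->
  normc (f.@[fun i => x i + h i] - f.@[x] - tangent f x h) <= C * M ^+ 2.

Lemma tangent_bound f x : exists C : R, 0 <= C /\
  forall h M, 0 <= M -> (forall i, normc (h i) <= M) -> normc (tangent f x h) <= C * M.
Proof.
exists (\sum_i normc (f^`M(i).@[x])); split=> [|h M M0 hM].
  by apply: sumr_ge0 => i _; exact: normc_ge0.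
rewrite (le_trans (normc_sum _ _)) // mulr_suml ler_sum // => i _.
by rewrite normcM ler_wpM2l ?normc_ge0.
Qed.

Lemma taylor f x : taylor_at x f.
Proof.
move: f; apply: mpoly_closed_ind => [c|i|f g [A [A0 hA]] [B [B0 hB]]|f g [A [A0 hA]] [B [B0 hB]]].
- exists 0; split=> // h M _ _ _; rewrite !mevalC subrr sub0r normcN /tangent.
  by rewrite big1 ?normc0 ?mul0r // => i _; rewrite mderivC meval0 mul0r.
- exists 0; split=> // h M _ _ _; rewrite !mevalXU /tangent (bigD1 i) //=.
  rewrite big1 => [|j ji]; last first.
    by rewrite mderivX mnm1E eq_sym (negPf ji) scale0r meval0 mul0r.
  rewrite mderivX mnm1E eqxx scale1r.
  have -> : (U_(i) - U_(i) = 0)%MM by apply/mnmP => j; rewrite mnmBE mnm0E subnn.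
  by rewrite mpolyX0 meval1 mul1r addr0 [x i + h i]addrC addrK subrr normc0 mul0r.
- exists (A + B); split=> [|h M M0 M1 hM]; first exact: addr_ge0.
  have -> : tangent (f + g) x h = tangent f x h + tangent g x h.
    by rewrite /tangent -big_split; apply: eq_bigr => i _; rewrite mderivD mevalD mulrDl.
  rewrite !mevalD mulrDl; apply: le_trans (lerD (hA h M M0 M1 hM) (hB h M M0 M1 hM)).
  by rewrite taylor_sum; exact: normcD.
- have [F [F0 hF]] := tangent_bound f x; have [G [G0 hG]] := tangent_bound g x.
  (* The three summands bound the three terms of [taylor_product], in the same order. *)
  exists (F * G + (normc f.@[x] + F + A) * B + A * (normc g.@[x] + G)).
  have n0 := @normc_ge0 R.
  split=> [|h M M0 M1 hM]; first by rewrite !addr_ge0 ?mulr_ge0 ?addr_ge0.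
  have -> : tangent (f * g) x h = f.@[x] * tangent g x h + tangent f x h * g.@[x].
    rewrite /tangent mulr_sumr mulr_suml -big_split; apply: eq_bigr => i _ /=.
    by rewrite mderivM mevalD !mevalM mulrDl mulrA addrC mulrAC.
  rewrite !mevalM.
  have := hF h M M0 hM; have := hG h M M0 hM; have := hA h M M0 M1 hM; have := hB h M M0 M1 hM.
  set f1 := f.@[fun i => _]; set g1 := g.@[fun i => _]; set f0 := f.@[x]; set g0 := g.@[x].
  set df := tangent f x h; set dg := tangent g x h => gs fr dgb dfb.
  have -> : f1 * g1 - f0 * g0 - (f0 * dg + df * g0) =
     df * dg + (f0 + df + (f1 - f0 - df)) * (g1 - g0 - dg) + (f1 - f0 - df) * (g0 + dg).
    exact: taylor_product.
  move: (f1 - f0 - df) (g1 - g0 - dg) gs fr => r s gs fr.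
  have MM : M ^+ 2 <= M by rewrite expr2 ler_piMr.
  have b1 : normc (df * dg) <= F * G * M ^+ 2.
    by rewrite normcM (le_trans (ler_pM (n0 _) (n0 _) dfb dgb)) // expr2 mulrACA.
  have b2 : normc ((f0 + df + r) * s) <= (normc f0 + F + A) * B * M ^+ 2.
    rewrite normcM -mulrA ler_pM // (le_trans (normcD _ _)) // lerD //.
      by rewrite (le_trans (normcD _ _)) // lerD // (le_trans dfb) // ler_piMr.
    by rewrite (le_trans fr) // ler_piMr // (le_trans MM).
  have b3 : normc (r * (g0 + dg)) <= A * (normc g0 + G) * M ^+ 2.
    rewrite normcM mulrAC ler_pM // (le_trans (normcD _ _)) // lerD //.
    by rewrite (le_trans dgb) // ler_piMr.
  rewrite !mulrDl in b1 b2 b3 *.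
  by rewrite (le_trans (normcD _ _)) // lerD // (le_trans (normcD _ _)) // lerD.
Qed.

Lemma meval_lipschitz f x : exists C : R, 0 <= C /\
  forall h (M : R), 0 <= M -> M <= 1 -> (forall i, normc (h i) <= M) ->
  normc (f.@[fun i => x i + h i] - f.@[x]) <= C * M.
Proof.
have [A [A0 hA]] := taylor f x; have [F [F0 hF]] := tangent_bound f x.
exists (A + F); split=> [|h M M0 M1 hM]; first exact: addr_ge0.
rewrite -(subrK (tangent f x h) (_ - _)) (le_trans (normcD _ _)) // mulrDl lerD ?hF //.
by rewrite (le_trans (hA h M M0 M1 hM)) // ler_wpM2l // expr2 ler_piMr.
Qed.

(** * Polynomials are determined by their values *)

Lemma mderiv_vanishing f i : (forall x, f.@[x] = 0) -> forall x, f^`M(i).@[x] = 0.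
Proof.
move=> f0 x; have [A [A0 hA]] := taylor f x.
apply/eqP; rewrite -normc_eq0; apply/eqP.
apply: (@eq0_of_quadratic_bound _ _ A (normc_ge0 _)) => t t0 t1.
pose h j : R[i] := if j == i then t%:C%C else 0.
have := hA h t (ltW t0) t1; rewrite !f0 subrr sub0r normcN /tangent.
rewrite (bigD1 i) //= big1 => [|j ji]; last by rewrite /h (negPf ji) mulr0.
rewrite addr0 /h eqxx normcM normc_real gtr0_norm // => hb; apply: hb => j.
by rewrite /h; case: eqP => _; [rewrite normc_real gtr0_norm|rewrite normc0 ltW].
Qed.

Lemma meval_at0 f : f.@[fun=> 0] = f@_0%MM.
Proof.
move: f; apply: mpoly_closed_ind => [c|i|f g|f g].
- by rewrite mevalC mcoeffC eqxx mulr1.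
- by rewrite mevalXU mcoeffX mnm1_eq0.
- by rewrite mevalD mcoeffD => -> ->.
- by rewrite mevalM mcoeff0_is_multiplicative => -> ->.
Qed.

(** All derivatives of [f] vanish everywhere too, and in characteristic 0 the coefficient at [m] is
    governed by that of a derivative at [m - U_(i)]. Descending on the degree leads to the constant
    coefficient, which is the value at 0. *)
Lemma mpoly_eq0_of_vanishing f : (forall x, f.@[x] = 0) -> f = 0.
Proof.
move=> f0; apply/mpolyP => m; rewrite mcoeff0.
have [d] := ubnP (mdeg m); elim: d => // d IH in m f f0 * => /ltnSE md.
have [->|m0] := eqVneq m 0%MM; first by rewrite -meval_at0 f0.
have [i mi] : exists i, m i != 0%N.
  apply/existsP; rewrite -negb_forall; apply: contra m0 => /forallP h.
  by apply/eqP/mnmP => i; rewrite mnm0E (eqP (h i)).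
have mE : (m - U_(i) + U_(i) = m)%MM.
  by apply/submK/mnm_lepP => j; rewrite mnm1E; case: eqP => // <-; rewrite lt0n.
have := IH (m - U_(i))%MM _ (mderiv_vanishing i f0).
rewrite mcoeff_deriv mE => /(_ _)/eqP; rewrite mulrn_eq0 /= => h; apply/eqP/h.
by move: md; rewrite -{1}mE mdegD mdeg1 addn1.
Qed.

Lemma mpoly_eq_of_meval f g : (forall x, f.@[x] = g.@[x]) -> f = g.
Proof.
move=> fg; apply/eqP; rewrite -subr_eq0; apply/eqP/mpoly_eq0_of_vanishing => x.
by rewrite mevalB fg subrr.
Qed.

End Taylor.

(** * Stable polynomials and reflections *)

Section StablePolynomial.
Variable R : rcfType.
Implicit Types (P Q : {poly R[i]}) (z w : R[i]).

Definition stable P : Prop := forall z, inD z -> P.[z] != 0.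

Lemma stable_factor P : stable P -> exists r : seq R[i],
  [/\ P = lead_coef P *: \prod_(a <- r) ('X - a%:P),
      size P = (size r).+1 & {in r, forall a, 1 <= normc a}].
Proof.
move=> sP; have [r Pr] := closed_field_poly_normal P; exists r.
have P0 : P != 0.
  by apply/eqP => P0; have := sP 0; rewrite P0 horner0 eqxx /inD normc0 ltr01 => /(_ isT).
split=> // [|a ar].
  by rewrite {1}Pr size_scale ?lead_coef_eq0 // size_prod_XsubC.
rewrite leNgt; apply/negP => a1; have := sP a a1; rewrite Pr hornerZ.
by have /eqP -> : root (\prod_(z <- r) ('X - z%:P)) a; rewrite ?root_prod_XsubC // mulr0 eqxx.
Qed.

Lemma horner_factor (r : seq R[i]) c z :
  normc (c *: \prod_(a <- r) ('X - a%:P)).[z] = normc c * \prod_(a <- r) normc (z - a).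
Proof.
rewrite hornerZ normcM; congr (_ * _).
elim: r => [|a r IH]; first by rewrite !big_nil hornerC normc1.
by rewrite !big_cons hornerM normcM IH hornerXsubC.
Qed.

(** By Vieta, [P.[0]] is, up to sign, the leading coefficient times the product of the roots, all of
    modulus at least 1. This replaces the maximum principle in [mrefl_le]. *)
Lemma stable_coef_le P d : stable P -> (size P <= d.+1)%N -> normc P`_d <= normc P.[0].
Proof.
move=> /stable_factor[r [Pr sr hr]]; rewrite leq_eqVlt => /orP[/eqP sd|sd]; last first.
  by rewrite nth_default // normc0 normc_ge0.
have -> : P`_d = lead_coef P by rewrite lead_coefE sd.
rewrite [in X in _ <= X]Pr horner_factor ler_peMr ?normc_ge0 //.
rewrite big_seq; apply: (big_ind (fun x : R => 1 <= x)) => // [x y|a ar].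
  exact: mulr_ege1.
by rewrite sub0r normcN hr.
Qed.

(** Compare root by root: [|w - a| <= 1 + |a|] and [|z - a| >= |a| - |z|], and [|a| >= 1] gives
    [(1 - |z|) / 2 * (1 + |a|) <= |a| - |z|]. The constant depends only on [d] and [|z|], hence
    survives limits of stable polynomials. *)
Lemma stable_harnack P d z w : stable P -> (size P <= d.+1)%N -> inD z -> inDbar w ->
  ((1 - normc z) / 2) ^+ d * normc P.[w] <= normc P.[z].
Proof.
rewrite /inD /inDbar => /stable_factor[r [Pr sr hr]] sd zD wD.
have n0 := @normc_ge0 R.
set e := (1 - normc z) / 2.
have e0 : 0 <= e by rewrite divr_ge0 // subr_ge0 ltW.
have e1 : e <= 1 by rewrite /e ler_pdivrMr //; have := n0 z; lra.
have rd : (size r <= d)%N by rewrite -ltnS -sr.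
apply: (@le_trans _ _ (e ^+ size r * normc P.[w])).
  by rewrite ler_wpM2r // ler_wiXn2l.
rewrite Pr !horner_factor mulrCA ler_wpM2l //.
have : \prod_(a <- r) (e * normc (w - a)) <= \prod_(a <- r) normc (z - a).
  rewrite big_seq [leRHS]big_seq; apply: ler_prod => a /hr ha.
  rewrite mulr_ge0 //=; have h1 := normcB w a; have h2 := normcBr a z.
  rewrite normc_distC in h2; apply: (le_trans _ h2); rewrite /e.
  by have := n0 z; nra.
by rewrite big_split /= big_const_seq count_predT iter_mulr_1.
Qed.

(** Here [d] is a nominal degree: [c] may be 0. This keeps the notion multiplicative when a factor
    such as [1 + Num.conj z *: 'X] drops in degree at [z = 0]. *)
Definition top_coef (d : nat) P (c : R[i]) : Prop := (size P <= d.+1)%N /\ P`_d = c.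

Lemma top_coefM d e P Q c c' : top_coef d P c -> top_coef e Q c' ->
  top_coef (d + e) (P * Q) (c * c').
Proof.
move=> [sP <-] [sQ <-]; split.
  by apply: leq_trans (size_polyMleq _ _) _; lia.
have lt_d : (d < (d + e).+1)%N by lia.
rewrite coefM (bigD1 (Ordinal lt_d)) //= addKn big1 ?addr0 // => j jd.
have {}jd : (j : nat) != d by [].
have [lt_j|le_j] := ltnP j d.
  by rewrite [Q`__]nth_default ?mulr0 //; apply: leq_trans sQ _; lia.
by rewrite [P`__]nth_default ?mul0r //; apply: leq_trans sP _; lia.
Qed.

Lemma top_coefX d P c k : top_coef d P c -> top_coef (d * k) (P ^+ k) (c ^+ k).
Proof.
move=> h; elim: k => [|k IH]; first by rewrite muln0; split; rewrite ?size_poly1 ?coefC.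
by rewrite mulnS !exprS; exact: top_coefM.
Qed.

(** The [a]-th power of the disc automorphism [w -> (w + z) / (1 + conj z w)], multiplied by the
    power [a + b] of its denominator. *)
Definition blaschke_factor z (a b : nat) : {poly R[i]} :=
  ('X + z%:P) ^+ a * (1 + Num.conj z *: 'X) ^+ b.

Lemma top_coef_blaschke_factor z a b :
  top_coef (a + b) (blaschke_factor z a b) (Num.conj z ^+ b).
Proof.
have A : top_coef 1 ('X + z%:P) 1.
  by split; [rewrite size_XaddC | rewrite coefD coefX coefC addr0].
have B : top_coef 1 (1 + Num.conj z *: 'X) (Num.conj z).
  split; last by rewrite coefD coefC coefZ coefX mulr1 add0r.
  rewrite (leq_trans (size_polyD _ _)) // geq_max size_poly1 /=.
  by rewrite (leq_trans (size_scale_leq _ _)) // size_polyX.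
by have := top_coefM (top_coefX a A) (top_coefX b B); rewrite !mul1n expr1n mul1r.
Qed.

Lemma horner_blaschke_factor z a b w : (blaschke_factor z a b).[w] =
  (w + z) ^+ a * (1 + Num.conj z * w) ^+ b.
Proof. by rewrite /blaschke_factor hornerM !horner_exp !hornerE. Qed.

(** The difference of the squared moduli is [(1 - |z|^2) (1 - |w|^2)]. *)
Lemma blaschke_lt z w : inD z -> inD w -> normc (w + z) < normc (1 + Num.conj z * w).
Proof.
rewrite /inD => zD wD; rewrite ltNge normc_le_sqr -ltNge.
have h (x : R[i]) : normc x < 1 -> normc x ^+ 2 < 1 by move=> ?; rewrite expr_lt1 ?normc_ge0.
move/h: zD; move/h: wD; case: z w => [a b] [c d].
have -> : ((c +i* d) + (a +i* b) = (c + a) +i* (d + b))%C by [].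
have -> : (1 + Num.conj (a +i* b) * (c +i* d) =
   (1 + (a * c - (- b) * d)) +i* (0 + (a * d + (- b) * c)))%C by [].
rewrite !normc_sqr => h1 h2.
have : 0 < (1 - (a ^+ 2 + b ^+ 2)) * (1 - (c ^+ 2 + d ^+ 2)) by rewrite mulr_gt0 ?subr_gt0.
by rewrite -subr_gt0 => h0; rewrite -subr_gt0; congr (0 < _): h0; ring.
Qed.

End StablePolynomial.

(** * Reflection on the torus and its bound on the polydisc *)

Section Reflection.
Variables (R : rcfType) (k : nat).
Implicit Types (f g : {mpoly R[i][k]}) (N m : 'X_{1..k}) (v : 'I_k -> R[i]).

(** Two reflections can be added termwise only over a common index list; [mrefl] itself sums over
    the support, which varies with [f]. *)
Lemma mrefl_big N f (s : seq 'X_{1..k}) : uniq s -> {subset msupp f <= s} ->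
  mrefl N f = \sum_(m <- s) Num.conj f@_m *: 'X_[(N - m)%MM].
Proof.
move=> us fs; rewrite /mrefl [RHS](bigID (mem (msupp f))) /= [X in _ = _ + X]big1.
  rewrite addr0 -[RHS]big_filter; apply: perm_big; apply: uniq_perm => [||m].
  - exact: msupp_uniq.
  - exact: filter_uniq.
  - by rewrite mem_filter andb_idr // => /fs.
by move=> m /memN_msupp_eq0 ->; rewrite rmorph0 scale0r.
Qed.

Lemma mreflD N f g : mrefl N (f + g) = mrefl N f + mrefl N g.
Proof.
pose s := undup (msupp f ++ msupp g ++ msupp (f + g)).
have sub h : {subset msupp h <= msupp f ++ msupp g ++ msupp (f + g)} -> {subset msupp h <= s}.
  by move=> hs m /hs; rewrite mem_undup.
rewrite !(@mrefl_big _ _ s) ?undup_uniq //; last 3 first.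
- by apply: sub => m ms; rewrite !mem_cat ms ?orbT.
- by apply: sub => m ms; rewrite !mem_cat ms ?orbT.
- by apply: sub => m ms; rewrite !mem_cat ms ?orbT.
by rewrite -big_split; apply: eq_bigr => m _ /=; rewrite mcoeffD rmorphD scalerDl.
Qed.

Lemma mreflZ N c f : mrefl N (c *: f) = Num.conj c *: mrefl N f.
Proof.
rewrite (@mrefl_big _ _ (msupp f)) ?msupp_uniq //; last exact: msuppZ_le.
by rewrite /mrefl scaler_sumr; apply: eq_bigr => m _; rewrite mcoeffZ rmorphM scalerA.
Qed.

Lemma mreflX N m : mrefl N 'X_[m] = 'X_[(N - m)%MM] :> {mpoly R[i][k]}.
Proof. by rewrite /mrefl msuppX big_seq1 mcoeffX eqxx rmorph1 scale1r. Qed.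

Lemma mrefl0 N : mrefl N (0 : {mpoly R[i][k]}) = 0.
Proof. by rewrite /mrefl msupp0 big_nil. Qed.

Lemma mrefl_sum N (I : Type) (s : seq I) (Q : pred I) (c : I -> R[i])
    (e : I -> 'X_{1..k}) :
  mrefl N (\sum_(m <- s | Q m) c m *: 'X_[e m]) =
  \sum_(m <- s | Q m) Num.conj (c m) *: 'X_[(N - e m)%MM].
Proof.
by elim/big_rec2: _ => [|m f g _ <-]; rewrite ?mrefl0 // mreflD mreflZ mreflX.
Qed.

Lemma mrefl_meval N f v : (mrefl N f).@[v] =
  \sum_(m <- msupp f) Num.conj f@_m * \prod_i v i ^+ (N i - m i).
Proof.
rewrite raddf_sum /=; apply: eq_bigr => m _; rewrite mevalZ mevalX.
by congr (_ * _); apply: eq_bigr => i _; rewrite mnmBE.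
Qed.

(** On the torus [conj v] inverts [v], so [v^(N - m)] equals [v^N] times the conjugate of [v^m]. The
    bound [m <= N] makes the truncated subtraction genuine. *)
Lemma mrefl_torus N f v : {in msupp f, forall m, (m <= N)%MM} -> (forall i, inT (v i)) ->
  (mrefl N f).@[v] = (\prod_i v i ^+ N i) * Num.conj f.@[v].
Proof.
move=> fN vT; rewrite mrefl_meval mevalE rmorph_sum mulr_sumr big_seq [RHS]big_seq.
apply: eq_bigr => m /fN/mnm_lepP mN; rewrite rmorphM rmorph_prod mulrCA; congr (_ * _).
rewrite -big_split; apply: eq_bigr => i _ /=; rewrite -{2}(subnK (mN i)) exprD -mulrA.
by rewrite rmorphXn -exprMn [v i * _]mulrC conj_inT // expr1n mulr1.
Qed.

(* Restricting [f] to the disc w |-> ((w + v_i) / (1 + conj v_i w))_i and clearing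
   denominators gives a stable polynomial in [w] whose constant term is [f(v)] and whose
   top coefficient is the conjugate of the reflection of [f] at [v]. *)
Lemma mrefl_le N f v : {in msupp f, forall m, (m <= N)%MM} ->
  (forall u, (forall i, inD (u i)) -> f.@[u] != 0) -> (forall i, inD (v i)) ->
  normc (mrefl N f).@[v] <= normc f.@[v].
Proof.
move=> fN f0 vD.
pose P := \sum_(m <- msupp f) f@_m *: \prod_i blaschke_factor (v i) (m i) (N i - m i).
have PE w : P.[w] = \sum_(m <- msupp f) f@_m *
    \prod_i ((w + v i) ^+ m i * (1 + Num.conj (v i) * w) ^+ (N i - m i)).
  rewrite horner_sum; apply: eq_bigr => m _; rewrite hornerZ horner_prod.
  by congr (_ * _); apply: eq_bigr => i _; rewrite horner_blaschke_factor.
have P0 : P.[0] = f.@[v].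
  rewrite PE mevalE; apply: eq_bigr => m _; congr (_ * _); apply: eq_bigr => i _.
  by rewrite add0r mulr0 addr0 expr1n mulr1.
have [sP cP] : top_coef (mdeg N) P (Num.conj (mrefl N f).@[v]).
  rewrite mrefl_meval rmorph_sum /P big_seq [X in top_coef _ _ X]big_seq.
  elim/big_rec2: _ => [|m c Q ms [sQ <-]]; first by split; rewrite ?size_poly0 ?coef0.
  have [s t] : top_coef (mdeg N) (\prod_i blaschke_factor (v i) (m i) (N i - m i))
      (\prod_i Num.conj (v i) ^+ (N i - m i)).
    rewrite mdegE; elim/big_rec3: _ => [|i x y z _ h]; first by split; rewrite ?size_poly1 ?coefC.
    apply: top_coefM h; have /mnm_lepP/(_ i) mN := fN m ms.
    by rewrite -{1}(subnKC mN); exact: top_coef_blaschke_factor.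
  split.
    by rewrite (leq_trans (size_polyD _ _)) // geq_max sQ (leq_trans (size_scale_leq _ _)).
  rewrite coefD coefZ t rmorphM rmorph_prod /= conjCK; congr (_ * _ + _).
  by apply: eq_bigr => i _; rewrite rmorphXn.
rewrite -(normc_conj (mrefl N f).@[v]) -cP -P0; apply: stable_coef_le sP => w wD.
have den i : 1 + Num.conj (v i) * w != 0.
  by rewrite -normc_gt0 (le_lt_trans (normc_ge0 _) (blaschke_lt (vD i) wD)).
pose u i := (w + v i) / (1 + Num.conj (v i) * w).
suff -> : P.[w] = (\prod_i (1 + Num.conj (v i) * w) ^+ N i) * f.@[u].
  rewrite mulf_neq0 //.
    by apply/prodf_neq0 => i _; rewrite expf_neq0.
  apply: f0 => i; rewrite /inD normcM normcV ltr_pdivrMr ?normc_gt0 //.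
  by rewrite mul1r blaschke_lt.
rewrite PE mevalE mulr_sumr big_seq [RHS]big_seq; apply: eq_bigr => m /fN/mnm_lepP mN.
rewrite mulrCA; congr (_ * _); rewrite -big_split; apply: eq_bigr => i _ /=.
rewrite -{2}(subnK (mN i)) exprD -mulrA -exprMn [_ * u i]mulrC divfK //.
exact: mulrC.
Qed.

End Reflection.

(** * Polynomials in two and three variables *)

Section Evaluation.
Variable R : rcfType.
Implicit Types (a b c x y z : R[i]).

Local Notation i0 := ord0.
Local Notation i1 := (lift ord0 ord0).
Local Notation i2 := (lift ord0 (lift ord0 ord0)).

Lemma meval_ev2 (q : {mpoly R[i][2]}) v : q.@[v] = ev2 q (v i0) (v i1).
Proof.
by apply: meval_eq => j; case: (unliftP ord0 j) => [j' ->|-> //]; rewrite (ord1 j').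
Qed.

Lemma meval_ev3 (p : {mpoly R[i][3]}) v : p.@[v] = ev3 p (v i0) (v i1) (v i2).
Proof.
apply: meval_eq => j; case: (unliftP ord0 j) => [j' ->|-> //].
by case: (unliftP ord0 j') => [j'' ->|-> //]; rewrite (ord1 j'').
Qed.

Lemma ev2E (q : {mpoly R[i][2]}) a b :
  ev2 q a b = \sum_(m <- msupp q) q@_m * (a ^+ m i0 * b ^+ m i1).
Proof.
by rewrite /ev2 mevalE; apply: eq_bigr => m _; rewrite !big_ord_recl big_ord0 mulr1.
Qed.

Lemma ev3E (p : {mpoly R[i][3]}) a b c :
  ev3 p a b c = \sum_(m <- msupp p) p@_m * (a ^+ m i0 * (b ^+ m i1 * c ^+ m i2)).
Proof.
by rewrite /ev3 mevalE; apply: eq_bigr => m _; rewrite !big_ord_recl big_ord0 mulr1.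
Qed.

Lemma eq_ev2 (f g : {mpoly R[i][2]}) : (forall a b, ev2 f a b = ev2 g a b) -> f = g.
Proof. by move=> fg; apply: mpoly_eq_of_meval => v; rewrite !meval_ev2. Qed.

Lemma eq_ev3 (f g : {mpoly R[i][3]}) :
  (forall a b c, ev3 f a b c = ev3 g a b c) -> f = g.
Proof. by move=> fg; apply: mpoly_eq_of_meval => v; rewrite !meval_ev3. Qed.

Lemma ev2_monomial (s : seq 'X_{1..3}) (Q : pred 'X_{1..3}) (f : 'X_{1..3} -> R[i])
    (e : 'X_{1..3} -> 'X_{1..2}) a b :
  ev2 (\sum_(m <- s | Q m) f m *: 'X_[e m]) a b =
  \sum_(m <- s | Q m) f m * (a ^+ e m i0 * b ^+ e m i1).
Proof.
rewrite /ev2 raddf_sum; apply: eq_bigr => m _.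
by rewrite /= mevalZ mevalX !big_ord_recl big_ord0 mulr1.
Qed.

Lemma msupp_le_mnm3 m n (p : {mpoly R[i][3]}) :
  (forall j : 'I_3, (degv p j <= mnm3 m n j)%N) ->
  {in msupp p, forall mo, (mo <= mnm3 m n)%MM}.
Proof.
move=> dp mo mop; apply/mnm_lepP => j; apply: leq_trans (dp j).
exact: (@leq_bigmax_seq _ _ xpredT (fun mo : 'X_{1..3} => mo j)).
Qed.

(** * Reflection of a polynomial of degree one in the last variable *)

Section LinearInLastVariable.
Variables (m n : nat) (p : {mpoly R[i][3]}) (p1 p2 : {mpoly R[i][2]}).
Hypothesis p_le : {in msupp p, forall mo, (mo <= mnm3 m n)%MM}.
Hypothesis pE : forall a b c, ev3 p a b c = ev2 p1 a b + c * ev2 p2 a b.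

Let proj (mo : 'X_{1..3}) : 'X_{1..2} := mnm2 (mo i0) (mo i1).

Let proj0 mo : proj mo i0 = mo i0. Proof. by rewrite mnmE. Qed.
Let proj1 mo : proj mo i1 = mo i1. Proof. by rewrite mnmE. Qed.

Let proj_le mo : mo \in msupp p -> (proj mo <= mnm2 m n)%MM.
Proof.
move=> /p_le/mnm_lepP h; apply/mnm_lepP => j; rewrite !mnmE.
have := h i0; have := h i1; rewrite !mnmE /=.
by case: (unliftP ord0 j) => [j' ->|-> //]; rewrite (ord1 j').
Qed.

Let last_le1 mo : mo \in msupp p -> (mo i2 <= 1)%N.
Proof. by move=> /p_le/mnm_lepP/(_ i2); rewrite !mnmE. Qed.

(** The hypothesis [pE] fixes [p1] and [p2] only through values. Writing them with coefficients of
    [p] transfers the multidegree bound of [p] to them. *)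
Lemma const_part : p1 = \sum_(mo <- msupp p | mo i2 == 0%N) p@_mo *: 'X_[proj mo].
Proof.
apply: eq_ev2 => a b; rewrite ev2_monomial.
have := pE a b 0; rewrite mul0r addr0 => <-; rewrite ev3E big_mkcond [RHS]big_mkcond.
apply: eq_bigr => mo _; rewrite proj0 proj1 /= expr0n; case: ifP => _.
  by rewrite mulr1.
by rewrite !mulr0.
Qed.

Lemma slope_part : p2 = \sum_(mo <- msupp p | mo i2 != 0%N) p@_mo *: 'X_[proj mo].
Proof.
apply: eq_ev2 => a b; rewrite ev2_monomial.
have -> : ev2 p2 a b = ev3 p a b 1 - ev3 p a b 0.
  by rewrite !pE mul0r mul1r addr0 addrAC subrr add0r.
rewrite !ev3E -sumrB [RHS]big_mkcond; apply: eq_bigr => mo _.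
rewrite proj0 proj1 expr1n expr0n /= mulr1; case: eqP => _ /=.
  by rewrite mulr1 subrr.
by rewrite !mulr0 subr0.
Qed.

(** Reflection is an involution only below the multidegree [(m, n)], since larger exponents would be
    truncated; [slope_part] supplies this bound. *)
Lemma mrefl_slope_part : mrefl (mnm2 m n) (mrefl (mnm2 m n) p2) = p2.
Proof.
rewrite slope_part [X in mrefl _ X]mrefl_sum mrefl_sum.
rewrite big_seq_cond [RHS]big_seq_cond; apply: eq_bigr => mo /andP[/proj_le/mnm_lepP h _].
rewrite conjCK; congr (_ *: 'X_[_]); apply/mnmP => j.
by rewrite !mnmBE subKn.
Qed.

(** Reflecting in degree 1 exchanges the exponents 0 and 1 of the last variable, so [p1] and [p2]
    trade places. *)
Lemma ev3_ptilde a b c : ev3 (ptilde m n p) a b c =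
  c * ev2 (mrefl (mnm2 m n) p1) a b + ev2 (mrefl (mnm2 m n) p2) a b.
Proof.
rewrite const_part slope_part !mrefl_sum !ev2_monomial mulr_sumr.
rewrite /ev3 mrefl_meval (bigID (fun mo : 'X_{1..3} => mo i2 == 0%N)) /=.
congr (_ + _).
  apply: eq_bigr => mo /eqP h; rewrite !big_ord_recl big_ord0 !mnmE h /= mulr1 expr1.
  by rewrite [RHS]mulrCA; congr (_ * _); rewrite mulrA mulrC.
rewrite big_seq_cond [RHS]big_seq_cond; apply: eq_bigr => mo /andP[mop h].
have h1 : mo i2 = 1%N by apply/eqP; rewrite eqn_leq last_le1 //= lt0n.
by rewrite !big_ord_recl big_ord0 !mnmE /= h1 subnn expr0 !mulr1.
Qed.

Lemma ev3_ptilde_torus a b c : inT a -> inT b -> inT c ->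
  ev3 (ptilde m n p) a b c = a ^+ m * b ^+ n * c * Num.conj (ev3 p a b c).
Proof.
move=> aT bT cT; rewrite {1}/ev3 mrefl_torus //.
  by rewrite !big_ord_recl big_ord0 !mnmE /= mulr1 expr1 mulrA.
by case=> [[|[|[|]]]].
Qed.

End LinearInLastVariable.

Lemma taylor3 (f : {mpoly R[i][3]}) t1 t2 t3 : exists D1 D2 D3 (C : R), 0 <= C /\
  forall h1 h2 h3 (M : R), 0 <= M -> M <= 1 ->
  normc h1 <= M -> normc h2 <= M -> normc h3 <= M ->
  normc (ev3 f (t1 + h1) (t2 + h2) (t3 + h3) - ev3 f t1 t2 t3
    - (D1 * h1 + D2 * h2 + D3 * h3)) <= C * M ^+ 2.
Proof.
pose x (j : 'I_3) := nth 0 [:: t1; t2; t3] j.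
have [C [C0 hC]] := taylor f x.
exists f^`M(i0).@[x], f^`M(i1).@[x], f^`M(i2).@[x], C; split=> // h1 h2 h3 M M0 M1 l1 l2 l3.
pose h (j : 'I_3) := nth 0 [:: h1; h2; h3] j.
have hM j : normc (h j) <= M by case: j => [[|[|[|]]]].
have := hC h M M0 M1 hM.
by rewrite !meval_ev3 /tangent !big_ord_recl big_ord0 addr0 -!addrA.
Qed.

Lemma ev2_lipschitz (f : {mpoly R[i][2]}) a b : exists C : R, 0 <= C /\
  forall x y (M : R), M <= 1 -> normc (x - a) <= M -> normc (y - b) <= M ->
  normc (ev2 f x y - ev2 f a b) <= C * M.
Proof.
pose v (j : 'I_2) := nth 0 [:: a; b] j.
have [C [C0 hC]] := meval_lipschitz f v.
exists C; split=> // x y M M1 hx hy.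
pose h (j : 'I_2) := nth 0 [:: x - a; y - b] j.
have hM j : normc (h j) <= M by case: j => [[|[|]]].
have := hC h M (le_trans (normc_ge0 _) hx) M1 hM.
by rewrite !meval_ev2 /v /h /= ![_ + (_ - _)]addrC !subrK.
Qed.

End Evaluation.

(** * Nontangential limits at boundary zeros *)

Section LocalAnalysis.
Variable R : rcfType.
Implicit Types (a b c w lam : R[i]).

Definition first_order (f : {mpoly R[i][3]}) t1 t2 t3 D1 D2 D3 (C : R) : Prop :=
  0 <= C /\ forall h1 h2 h3 (M : R), 0 <= M -> M <= 1 ->
  normc h1 <= M -> normc h2 <= M -> normc h3 <= M ->
  normc (ev3 f (t1 + h1) (t2 + h2) (t3 + h3) - ev3 f t1 t2 t3
    - (D1 * h1 + D2 * h2 + D3 * h3)) <= C * M ^+ 2.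

(** Along the third axis [f] is exactly affine, so [(v t1 t2 - D3) t] is of order [t ^+ 2] and the
    third derivative must be [v t1 t2]. *)
Lemma first_order_affine f (u v : R[i] -> R[i] -> R[i]) t1 t2 t3 :
  (forall a b c, ev3 f a b c = u a b + c * v a b) ->
  exists D1 D2 C, first_order f t1 t2 t3 D1 D2 (v t1 t2) C.
Proof.
move=> fE; have [D1 [D2 [D3 [C [C0 hC]]]]] := taylor3 f t1 t2 t3.
suff <- : D3 = v t1 t2 by exists D1, D2, C.
apply/esym/eqP; rewrite -subr_eq0 -normc_eq0; apply/eqP.
apply: (@eq0_of_quadratic_bound _ _ C (normc_ge0 _)) => t t0 t1'.
have nt : normc (t%:C%C : R[i]) = t by rewrite normc_real gtr0_norm.
have := hC 0 0 t%:C%C t (ltW t0) t1'; rewrite normc0 nt (ltW t0) => /(_ isT isT (lexx _)).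
rewrite !fE !addr0 !mulr0 !add0r.
have -> : forall (K : comNzRingType) (x y z s d : K),
    x + (y + s) * z - (x + y * z) - d * s = (z - d) * s by move=> *; ring.
by rewrite normcM nt.
Qed.

Lemma first_order_lipschitz f t1 t2 t3 D1 D2 D3 C : first_order f t1 t2 t3 D1 D2 D3 C ->
  exists L : R, 0 <= L /\ forall h1 h2 h3 (M : R), 0 <= M -> M <= 1 ->
  normc h1 <= M -> normc h2 <= M -> normc h3 <= M ->
  normc (ev3 f (t1 + h1) (t2 + h2) (t3 + h3) - ev3 f t1 t2 t3) <= L * M.
Proof.
move=> [C0 hC]; have n0 := @normc_ge0 R.
exists (C + (normc D1 + normc D2 + normc D3)); split; first by rewrite !addr_ge0.
move=> h1 h2 h3 M M0 M1 l1 l2 l3.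
rewrite -(subrK (D1 * h1 + D2 * h2 + D3 * h3) (_ - _)) (le_trans (normcD _ _)) // mulrDl lerD //.
  by rewrite (le_trans (hC _ _ _ _ M0 M1 l1 l2 l3)) // ler_wpM2l // expr2 ler_piMr.
rewrite !mulrDl (le_trans (normcD _ _)) // lerD ?normcM ?ler_wpM2l //.
by rewrite (le_trans (normcD _ _)) // lerD ?normcM ?ler_wpM2l.
Qed.

Lemma normc_shrink (s : R) t : inT t -> s <= 1 -> normc (t + - (s%:C%C * t)) = 1 - s.
Proof.
move=> tT s1; have -> : t + - (s%:C%C * t) = (1 - s)%:C%C * t.
  by rewrite rmorphB rmorph1 mulrBl mul1r.
by rewrite normcM tT mulr1 normc_real ger0_norm ?subr_ge0.
Qed.

Lemma phi3_distE m n (p : {mpoly R[i][3]}) lam a b c : ev3 p a b c != 0 ->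
  normc (phi3 m n p a b c - lam) =
  normc (ev3 (ptilde m n p - lam *: p) a b c) / normc (ev3 p a b c).
Proof.
move=> p0; rewrite -normcV -normcM; congr normc.
by rewrite /phi3 {3}/ev3 mevalB mevalZ mulrBl mulfK.
Qed.

(** Along the path with displacement [-(t t1, t t2, t r t3)] the numerator is [-t S] up to [O(t^2)],
    with [S] the left side of the conclusion. The limit makes it [o(p)], while [p = O(t)]; hence
    [S = 0]. *)
Lemma nt_limit_annihilates m n (p : {mpoly R[i][3]}) t1 t2 t3 lam D1 D2 D3 C :
  (forall a b c, inD a -> inD b -> inD c -> ev3 p a b c != 0) ->
  inT t1 -> inT t2 -> inT t3 -> ev3 p t1 t2 t3 = 0 ->
  ev3 (ptilde m n p - lam *: p) t1 t2 t3 = 0 ->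
  first_order (ptilde m n p - lam *: p) t1 t2 t3 D1 D2 D3 C ->
  nt_limit m n p t1 t2 t3 lam ->
  forall r : R, 1 <= r -> r <= 2 -> D1 * t1 + D2 * t2 + D3 * (r%:C%C * t3) = 0.
Proof.
move=> pD T1 T2 T3 p0 N0 [C0 hN] nt r r1 r2.
have [G1 [G2 [G3 [C' hp]]]] := taylor3 p t1 t2 t3.
have [L [L0 hL]] := first_order_lipschitz hp.
apply/eqP; rewrite -normc_eq0 eq_le normc_ge0 andbT.
(* The term [2 L e] comes from [e |p| <= e L (2 t)], and [4 C e] from the remainder [C (2 t)^2] with
   [t <= e]. *)
apply: (@le0_of_linear_bound _ _ (2 * L + 4 * C)) => e e0 e1.
(* Aperture 2 suffices: as [1 <= r <= 2], the displacement is at most [2 t], and the distance to the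
   boundary is [t]. *)
have [d d0 hd] := nt 2 (ltr0n _ 2) e e0.
pose t := Num.min (d / 4) (Num.min e (1 / 4)).
have t0 : 0 < t by rewrite !lt_min e0 !divr_gt0.
have : t <= d / 4 /\ t <= e /\ t <= 1 / 4 by rewrite !ge_min !lexx !orbT.
move=> [td [te t4]].
have [tr0 tr1 tr2 tr3] : [/\ 0 <= t * r, t <= t * r, t * r <= 2 * t & t * r <= 1 / 2] by split; nra.
have nt0 : normc (t%:C%C : R[i]) = t by rewrite normc_real gtr0_norm.
have ntr : normc ((t * r)%:C%C : R[i]) = t * r by rewrite normc_real ger0_norm.
pose h1 := - (t%:C%C * t1); pose h2 := - (t%:C%C * t2); pose h3 := - ((t * r)%:C%C * t3).
have [n1 n2 n3] : [/\ normc h1 = t, normc h2 = t & normc h3 = t * r].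
  by split; rewrite normcN normcM ?nt0 ?ntr ?T1 ?T2 ?T3 mulr1.
have [z1 z2 z3] : [/\ normc (t1 + h1) = 1 - t, normc (t2 + h2) = 1 - t &
    normc (t3 + h3) = 1 - t * r] by split; apply: normc_shrink => //; lra.
have [d1 d2 d3] : [/\ inD (t1 + h1), inD (t2 + h2) & inD (t3 + h3)].
  by rewrite /inD z1 z2 z3; split; lra.
have p_neq0 := pD _ _ _ d1 d2 d3.
have := hd _ _ _ d1 d2 d3; rewrite phi3_distE // ltr_pdivrMr ?normc_gt0 //.
have dist (x h : R[i]) : x + h - x = h by rewrite addrAC subrr add0r.
rewrite /norm3 !dist n1 n2 n3 z1 z2 z3.
have A : Num.max t (Num.max t (t * r)) <= 2 * t by rewrite !ge_max; apply/and3P; split; lra.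
have B : Num.max (1 - t) (Num.max (1 - t) (1 - t * r)) <= 1 - t.
  by rewrite !ge_max; apply/and3P; split; lra.
move=> /(_ _ _)/ltW Np; have {}Np := Np ltac:(lra) ltac:(lra).
have M0 : 0 <= 2 * t by lra.
have M1 : 2 * t <= 1 by lra.
have [b1 b2 b3] : [/\ normc h1 <= 2 * t, normc h2 <= 2 * t & normc h3 <= 2 * t].
  by rewrite n1 n2 n3; split; lra.
have := hL _ _ _ _ M0 M1 b1 b2 b3; rewrite p0 subr0 => hpb.
have := hN _ _ _ _ M0 M1 b1 b2 b3; rewrite N0 subr0.
have -> : D1 * h1 + D2 * h2 + D3 * h3 =
    - (t%:C%C * (D1 * t1 + D2 * t2 + D3 * (r%:C%C * t3))).
  rewrite /h1 /h2 /h3 rmorphM.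
  have aux (K : comNzRingType) (a1 a2 a3 b1' b2' b3' s q : K) :
     a1 * - (s * b1') + a2 * - (s * b2') + a3 * - (s * q * b3') =
     - (s * (a1 * b1' + a2 * b2' + a3 * (q * b3'))) by ring.
  exact: aux.
set S := _ + D3 * (r%:C%C * t3); rewrite opprK [ev3 _ _ _ _ + _]addrC => hS.
have := normcBr (t%:C%C * S) (- ev3 (ptilde m n p - lam *: p) (t1 + h1) (t2 + h2) (t3 + h3)).
rewrite opprK normcN normcM nt0 => hS'.
have hpe : e * normc (ev3 p (t1 + h1) (t2 + h2) (t3 + h3)) <= e * (L * (2 * t)) by rewrite ler_pM2l.
rewrite -(ler_pM2l t0).
have : C * (2 * t) ^+ 2 <= C * (4 * t * e) by rewrite ler_wpM2l //; nra.
lra.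
Qed.


(** The square of [|1 - t w|] is [1 - 2 t Re w + t^2 |w|^2], below 1 for [t <= Re w / |w|^2]. *)
Lemma approach w : 0 < complex.Re w -> exists t0 : R, [/\ 0 < t0, t0 <= 1 &
  forall t : R, 0 < t -> t <= t0 -> normc (1 - t%:C%C * w) < 1].
Proof.
case: w => a b /= a0; have s0 : 0 < a ^+ 2 + b ^+ 2.
  by rewrite ltr_wpDr ?sqr_ge0 // exprn_gt0.
exists (Num.min 1 (a / (a ^+ 2 + b ^+ 2))); split; first by rewrite lt_min ltr01 divr_gt0.
  by rewrite ge_min lexx.
move=> t t0; rewrite le_min => /andP[t1]; rewrite ler_pdivlMr // => ts.
rewrite -[ltLHS]/(normc ((1 - (t * a - 0 * b)) +i* (0 - (t * b + 0 * a)))%C).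
rewrite ltNge -{1}normc1 normc_le_sqr normc1 -ltNge normc_sqr.
nra.
Qed.

(** Blowing up the tridisk at a torus point gives a product of right half planes, with points
    [t_i (1 - t w_i)]. At this scale [f] and [g] are [-t] times their linear parts up to [O(t^2)],
    so the inequality passes to the linear parts. *)
Lemma tangent_contraction (f g : {mpoly R[i][3]}) t1 t2 t3 lam D1 D2 D3 C E1 E2 E3 C' :
  (forall a b c, inD a -> inD b -> inD c ->
     normc (ev3 f a b c + lam * ev3 g a b c) <= normc (ev3 g a b c)) ->
  inT lam -> inT t1 -> inT t2 -> inT t3 -> ev3 f t1 t2 t3 = 0 -> ev3 g t1 t2 t3 = 0 ->
  first_order f t1 t2 t3 D1 D2 D3 C -> first_order g t1 t2 t3 E1 E2 E3 C' ->
  forall w1 w2 w3, 0 < complex.Re w1 -> 0 < complex.Re w2 -> 0 < complex.Re w3 ->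
  normc (D1 * t1 * w1 + D2 * t2 * w2 + D3 * t3 * w3
    + lam * (E1 * t1 * w1 + E2 * t2 * w2 + E3 * t3 * w3)) <=
  normc (E1 * t1 * w1 + E2 * t2 * w2 + E3 * t3 * w3).
Proof.
move=> fg lamT T1 T2 T3 f0 g0 [C0 hf] [C'0 hg] w1 w2 w3 r1 r2 r3.
set S := _ + D3 * t3 * w3; set T := _ + E3 * t3 * w3.
have [u1 [u1p u1le hu1]] := approach r1.
have [u2 [u2p u2le hu2]] := approach r2.
have [u3 [u3p u3le hu3]] := approach r3.
have n0 := @normc_ge0 R.
pose W := 1 + normc w1 + normc w2 + normc w3.
have W1 : 1 <= W by rewrite /W -!addrA lerDl !addr_ge0.
have W0 : 0 < W by lra.
pose u := Num.min u1 (Num.min u2 (Num.min u3 W^-1)).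
have u0 : 0 < u by rewrite !lt_min u1p u2p u3p invr_gt0.
have [uu1 uu2 uu3 uW] : [/\ u <= u1, u <= u2, u <= u3 & u <= W^-1].
  by rewrite !ge_min !lexx !orbT.
(* With [t = u s] the parameter [s] runs over [(0, 1]]. The remainder of [g] counts twice because
   [g] occurs on both sides. *)
rewrite -subr_le0; apply: (@le0_of_linear_bound _ _ ((C + 2 * C') * W ^+ 2)) => s s0 s1.
pose t := u * s; have t0 : 0 < t by rewrite mulr_gt0.
have tu : t <= u by rewrite ler_piMr // ltW.
have ts : t <= s by rewrite ler_piMl ?(ltW s0) // (le_trans uu1).
have nt : normc (t%:C%C : R[i]) = t by rewrite normc_real gtr0_norm.
pose h1 := - (t%:C%C * t1 * w1); pose h2 := - (t%:C%C * t2 * w2); pose h3 := - (t%:C%C * t3 * w3).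
have inside x w : inT x -> normc (1 - t%:C%C * w) < 1 -> inD (x + - (t%:C%C * x * w)).
  move=> xT h; rewrite /inD; have -> : x + - (t%:C%C * x * w) = x * (1 - t%:C%C * w).
    by rewrite mulrBr mulr1 mulrA [x * _]mulrC.
  by rewrite normcM xT mul1r.
have d1 : inD (t1 + h1) by apply: inside => //; apply: hu1 => //; apply: le_trans tu _.
have d2 : inD (t2 + h2) by apply: inside => //; apply: hu2 => //; apply: le_trans tu _.
have d3 : inD (t3 + h3) by apply: inside => //; apply: hu3 => //; apply: le_trans tu _.
have M0 : 0 <= t * W by rewrite mulr_ge0 ?ltW.
have M1 : t * W <= 1 by rewrite -ler_pdivlMr // mul1r (le_trans tu).
have bound x w : inT x -> normc w <= W -> normc (- (t%:C%C * x * w)) <= t * W.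
  by move=> xT h; rewrite normcN !normcM xT nt mulr1 ler_pM2l.
have b1 : normc h1 <= t * W by apply: bound => //; rewrite /W; have := n0 w2; have := n0 w3; lra.
have b2 : normc h2 <= t * W by apply: bound => //; rewrite /W; have := n0 w1; have := n0 w3; lra.
have b3 : normc h3 <= t * W by apply: bound => //; rewrite /W; have := n0 w1; have := n0 w2; lra.
have := hf _ _ _ _ M0 M1 b1 b2 b3; have := hg _ _ _ _ M0 M1 b1 b2 b3.
have := fg _ _ _ d1 d2 d3; rewrite f0 g0 !subr0.
have lin (K : comNzRingType) (a1 a2 a3 x1 x2 x3 v1 v2 v3 r : K) :
   a1 * - (r * x1 * v1) + a2 * - (r * x2 * v2) + a3 * - (r * x3 * v3) =
   - (r * (a1 * x1 * v1 + a2 * x2 * v2 + a3 * x3 * v3)) by ring.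
rewrite !lin -/S -/T !opprK.
set F := ev3 f _ _ _; set G := ev3 g _ _ _ => FG hG hF.
have : normc (t%:C%C * (S + lam * T)) <= normc (F + lam * G) + normc (F + t%:C%C * S)
    + normc (G + t%:C%C * T).
  have -> : t%:C%C * (S + lam * T) = (F + t%:C%C * S) + (lam * (G + t%:C%C * T)) - (F + lam * G).
    have aux (K : comNzRingType) (r x y l a b : K) :
      r * (x + l * y) = (a + r * x) + l * (b + r * y) - (a + l * b) by ring.
    exact: aux.
  apply: le_trans (normcB _ _) _; rewrite [leLHS]addrC -[leRHS]addrA lerD2l.
  by rewrite (le_trans (normcD _ _)) // normcM lamT mul1r.
have := normcBr G (- (t%:C%C * T)); rewrite opprK normcN !normcM nt => GT ST.
rewrite -(ler_pM2l t0).
have : (C + 2 * C') * (t * W) ^+ 2 <= t * ((C + 2 * C') * W ^+ 2 * s).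
  have -> : (C + 2 * C') * (t * W) ^+ 2 = (t * ((C + 2 * C') * W ^+ 2)) * t by ring.
  rewrite [leRHS]mulrA ler_wpM2l //.
  by rewrite mulr_ge0 ?(ltW t0) // mulr_ge0 ?sqr_ge0 // addr_ge0 // mulr_ge0.
rewrite mulrBr; lra.
Qed.

(** After cancelling squares the hypothesis says that a function affine in [y], of slope
    [2 (s2 c1 - s1 c2)], stays nonpositive on the whole line; so the slope is 0. *)
Lemma half_plane_parallel (s1 s2 u v c1 c2 : R) :
  (forall y, (s1 + (u - c2 * y)) ^+ 2 + (s2 + (v + c1 * y)) ^+ 2 <=
     (u - c2 * y) ^+ 2 + (v + c1 * y) ^+ 2) -> s2 * c1 - s1 * c2 = 0.
Proof.
move=> h; apply/eqP/negP => /negP B0.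
pose A := s1 ^+ 2 + s2 ^+ 2 + 2 * (s1 * u + s2 * v).
(* At this [y] the affine function would take the value 1. *)
have hy := h ((1 - A) / (2 * (s2 * c1 - s1 * c2))).
set y := (1 - A) / _ in hy.
have yB : 2 * (s2 * c1 - s1 * c2) * y = 1 - A.
  by rewrite /y mulrC divfK // mulf_neq0 // pnatr_eq0.
have : A + 2 * (s2 * c1 - s1 * c2) * y <= 0.
  rewrite -subr_ge0 in hy; rewrite -oppr_ge0; congr (0 <= _): hy; rewrite /A; ring.
by rewrite yB; lra.
Qed.

(* For fixed [w1, w2] the right-hand arguments sweep a line as the imaginary part of [w3]
   varies, which forces [A w1 + B w2] to be a real multiple of [lam E3]; moving [w1] in two
   real-independent directions then leaves only [A = 0]. *)
Lemma contraction_coef_eq0 lam A B E1 E2 E3 : inT lam -> E3 != 0 ->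
  (forall w1 w2 w3, 0 < complex.Re w1 -> 0 < complex.Re w2 -> 0 < complex.Re w3 ->
    normc (A * w1 + B * w2 + lam * (E1 * w1 + E2 * w2 + E3 * w3)) <=
    normc (E1 * w1 + E2 * w2 + E3 * w3)) -> A = 0.
Proof.
move=> lamT E30 h.
have c0 : lam * E3 != 0 by rewrite mulf_neq0 // inT_neq0.
have par w1 w2 : 0 < complex.Re w1 -> 0 < complex.Re w2 ->
    complex.Im (A * w1 + B * w2) * complex.Re (lam * E3)
    - complex.Re (A * w1 + B * w2) * complex.Im (lam * E3) = 0.
  move=> p1 p2; pose X := lam * (E1 * w1 + E2 * w2 + E3).
  apply: (@half_plane_parallel _ _ (complex.Re X) (complex.Im X)) => y.
  have := h w1 w2 (1 +i* y)%C p1 p2 ltr01.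
  set T := _ + E3 * _.
  have -> : normc T = normc (lam * T) by rewrite normcM lamT mul1r.
  have -> : lam * T = X + lam * E3 * (0 +i* y)%C.
    rewrite /X -mulrA -mulrDr; congr (_ * _); rewrite /T -[RHS]addrA; congr (_ + _).
    rewrite -{2}(mulr1 E3) -mulrDr; congr (_ * _).
    by apply/eqP; rewrite eq_complex /= addr0 add0r !eqxx.
  case: (A * w1 + B * w2) X (lam * E3) => [s1 s2] [u v] [c1 c2].
  have -> : (u +i* v)%C + (c1 +i* c2)%C * (0 +i* y)%C =
     ((u + (c1 * 0 - c2 * y)) +i* (v + (c1 * y + c2 * 0)))%C by [].
  rewrite mulr0 mulr0 addr0 sub0r normc_le_sqr normc_sqr.
  by rewrite normc_sqr.
have q1 := par 1 1 ltr01 ltr01.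
have q2 := par (2 +i* 0)%C 1 (ltr0n _ 2) ltr01.
have q3 := par (1 +i* 1)%C 1 ltr01 ltr01.
move: c0 q1 q2 q3; case: A B (lam * E3) {par h} => [a1 a2] [b1 b2] [c1 c2] /= c0 q1 q2 q3.
have e1 : a2 * c1 - a1 * c2 = 0 by lra.
have e2 : a1 * c1 + a2 * c2 = 0 by lra.
have cpos : 0 < c1 ^+ 2 + c2 ^+ 2.
  rewrite lt_def addr_ge0 ?sqr_ge0 // andbT; apply: contra c0.
  by rewrite paddr_eq0 ?sqr_ge0 // !sqrf_eq0 eq_complex.
have : (a1 ^+ 2 + a2 ^+ 2) * (c1 ^+ 2 + c2 ^+ 2) = 0.
  have -> : (a1 ^+ 2 + a2 ^+ 2) * (c1 ^+ 2 + c2 ^+ 2) =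
     (a2 * c1 - a1 * c2) ^+ 2 + (a1 * c1 + a2 * c2) ^+ 2 by ring.
  by rewrite e1 e2 expr0n addr0.
move/eqP; rewrite mulf_eq0 (gt_eqF cpos) orbF paddr_eq0 ?sqr_ge0 // !sqrf_eq0.
by move=> h; apply/eqP; rewrite eq_complex.
Qed.

(** The numerator is at most [C M^2] with [M] the distance to the point. In the approach region
    [M <= K (1 - |c|)], so dividing by [kappa (1 - |c|)] leaves a quantity of order [M]. *)
Lemma nt_limit_of_flat m n (p : {mpoly R[i][3]}) t1 t2 t3 lam C (kappa r : R) :
  (forall a b c, inD a -> inD b -> inD c -> ev3 p a b c != 0) ->
  ev3 (ptilde m n p - lam *: p) t1 t2 t3 = 0 ->
  first_order (ptilde m n p - lam *: p) t1 t2 t3 0 0 0 C ->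
  0 < kappa -> 0 < r ->
  (forall a b c, inD a -> inD b -> inD c -> normc (a - t1) < r -> normc (b - t2) < r ->
    kappa * (1 - normc c) <= normc (ev3 p a b c)) ->
  nt_limit m n p t1 t2 t3 lam.
Proof.
move=> pD N0 [C0 hN] k0 r0 low K K0 e e0.
have CK : 0 < C * K + 1 by rewrite ltr_wpDl // mulr_ge0 // ltW.
exists (Num.min (Num.min 1 r) (e * kappa / (C * K + 1))).
  by rewrite !lt_min ltr01 r0 divr_gt0 ?mulr_gt0.
move=> a b c aD bD cD; set M := norm3 _ _ _; rewrite !lt_min => hK /andP[/andP[M1 Mr]].
rewrite ltr_pdivlMr // => Me.
have [m1 m2 m3] : [/\ normc (a - t1) <= M, normc (b - t2) <= M & normc (c - t3) <= M].
  by rewrite /M /norm3 !le_max !lexx !orbT.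
have M0 : 0 <= M by apply: le_trans (normc_ge0 _) m1.
have cle : normc c <= norm3 a b c by rewrite /norm3 !le_max lexx !orbT.
have c1 : 0 < 1 - normc c by rewrite subr_gt0.
rewrite phi3_distE ?pD //; have := hN _ _ _ _ M0 (ltW M1) m1 m2 m3.
rewrite !mul0r !addr0 N0 !subr0 ![_ + (_ - _)]addrC !subrK => hNM.
have {}low := low _ _ _ aD bD cD (le_lt_trans m1 Mr) (le_lt_trans m2 Mr).
rewrite ltr_pdivrMr ?normc_gt0 ?pD //.
apply: (le_lt_trans hNM); apply: (@lt_le_trans _ _ (e * (kappa * (1 - normc c)))); last first.
  by rewrite ler_pM2l.
have MK : M <= K * (1 - normc c) by apply: (le_trans hK); rewrite ler_pM2l // lerD2l lerN2.
have h1 : C * M ^+ 2 <= C * M * (K * (1 - normc c)).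
  by rewrite expr2 mulrA ler_wpM2l // mulr_ge0.
apply: (le_lt_trans h1).
have -> : C * M * (K * (1 - normc c)) = (M * (C * K)) * (1 - normc c) by ring.
rewrite [ltRHS]mulrA ltr_pM2r //; apply: le_lt_trans Me.
by rewrite ler_wpM2l // lerDl.
Qed.

End LocalAnalysis.

(** * Limits of zero free polynomials *)

Section Hurwitz.
Variable R : rcfType.
Implicit Types (a b z w : R[i]) (f g q : {mpoly R[i][2]}).

Definition poly_fun d (F : R[i] -> R[i]) : Prop :=
  exists2 P : {poly R[i]}, (size P <= d.+1)%N & forall z, F z = P.[z].

Lemma poly_fun_sum (s : seq 'X_{1..2}) (i : 'I_2) (c : 'X_{1..2} -> R[i]) d :
  {in s, forall m, (mdeg m <= d)%N} ->
  poly_fun d (fun z => \sum_(m <- s) c m * z ^+ m i).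
Proof.
move=> sd; exists (\sum_(m <- s) c m *: 'X^(m i)).
  rewrite big_seq; elim/big_rec: _ => [|m P ms hP]; first by rewrite size_poly0.
  rewrite (leq_trans (size_polyD _ _)) // geq_max hP andbT.
  rewrite (leq_trans (size_scale_leq _ _)) // size_polyXn ltnS (leq_trans _ (sd m ms)) //.
  by rewrite mdegE (bigD1 i) //= leq_addr.
by move=> z; rewrite horner_sum; apply: eq_bigr => m _; rewrite hornerZ hornerXn.
Qed.

Lemma ev2_poly_fun_l q d b : (msize q <= d)%N -> poly_fun d (fun a => ev2 q a b).
Proof.
move=> qd; have [m ms|P sP hP] :=
    @poly_fun_sum (msupp q) ord0 (fun m => q@_m * b ^+ m (lift ord0 ord0)) d.
  by rewrite ltnW // (leq_trans (msize_mdeg_lt ms)).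
exists P => // z; rewrite -hP ev2E; apply: eq_bigr => m _.
by rewrite [z ^+ _ * _]mulrC mulrA.
Qed.

Lemma ev2_poly_fun_r q d a : (msize q <= d)%N -> poly_fun d (fun b => ev2 q a b).
Proof.
move=> qd; have [m ms|P sP hP] :=
    @poly_fun_sum (msupp q) (lift ord0 ord0) (fun m => q@_m * a ^+ m ord0) d.
  by rewrite ltnW // (leq_trans (msize_mdeg_lt ms)).
exists P => // z; rewrite -hP ev2E; apply: eq_bigr => m _.
by rewrite mulrA.
Qed.

Lemma poly_fun_harnack d F z w : poly_fun d F -> (forall z, inD z -> F z != 0) ->
  inD z -> inDbar w -> ((1 - normc z) / 2) ^+ d * normc (F w) <= normc (F z).
Proof.
move=> [P sP FP] F0 zD wD; rewrite !FP; apply: stable_harnack => // x xD.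
by rewrite -FP F0.
Qed.

Lemma poly_fun_eq0 d F : poly_fun d F -> (forall z, inD z -> F z = 0) -> forall z, F z = 0.
Proof.
move=> [P sP FP] F0 z; rewrite FP; suff -> : P = 0 by rewrite horner0.
(* The points [1 / (k + 2)] are distinct and strictly inside the disc, and [size P] of them are too
   many roots. *)
pose r (k : nat) : R[i] := k.+2%:R^-1.
apply: (@roots_geq_poly_eq0 _ _ [seq r k | k <- iota 0 (size P)]).
- apply/allP => _ /mapP[k _ ->]; rewrite /root -FP F0 // /inD normcV.
  rewrite -(rmorph_nat (real_complex R)) normc_real ger0_norm // invf_lt1 ?ltr0n //.
  by rewrite ltr1n.
- rewrite map_inj_uniq ?iota_uniq // => i j /invr_inj/eqP; rewrite eqr_nat => /eqP.
  by case.
- by rewrite size_map size_iota.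
Qed.

(** Two Harnack steps, one per variable, bound a fixed multiple of [|f + s g|] at any point of the
    bidisk by its value [s |g|] at the zero [(a0, b0)] of [f]. Letting [s] tend to 0 kills [f] on
    the bidisk. *)
Lemma hurwitz_bidisk f g a0 b0 :
  (forall s : R, 0 < s -> s <= 1 -> forall a b, inD a -> inD b ->
     ev2 (f + s%:C%C *: g) a b != 0) ->
  inD a0 -> inD b0 -> ev2 f a0 b0 = 0 -> f = 0.
Proof.
move=> fg aD bD f0; pose d := maxn (msize f) (msize g).
have df : (msize f <= d)%N by rewrite leq_maxl.
have ds (s : R) : (msize (f + s%:C%C *: g) <= d)%N.
  rewrite (leq_trans (msizeD_le _ _)) // geq_max df /=.
  by rewrite (leq_trans (msizeZ_le _ _)) // leq_maxr.
have evD (s : R) a b : ev2 (f + s%:C%C *: g) a b = ev2 f a b + s%:C%C * ev2 g a b.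
  by rewrite /ev2 mevalD mevalZ.
have sub (x : R[i]) : inD x -> inDbar x by exact: ltW.
pose K := ((1 - normc a0) / 2) ^+ d * ((1 - normc b0) / 2) ^+ d.
have K0 : 0 < K by rewrite mulr_gt0 ?exprn_gt0 ?divr_gt0 ?subr_gt0.
have fD a b : inD a -> inD b -> ev2 f a b = 0.
  move=> a'D b'D; apply/eqP; rewrite -normc_eq0 eq_le normc_ge0 andbT.
  rewrite -(pmulr_rle0 _ K0).
  apply: (@le0_of_linear_bound _ _ (normc (ev2 g a0 b0) + K * normc (ev2 g a b))) => s s0 s1.
  have h1 := poly_fun_harnack (ev2_poly_fun_l b0 (ds s)) (fun z zD => fg s s0 s1 z b0 zD bD)
    aD (sub _ a'D).
  have h2 := poly_fun_harnack (ev2_poly_fun_r a (ds s)) (fun z zD => fg s s0 s1 a z a'D zD)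
    bD (sub _ b'D).
  have h3 : K * normc (ev2 f a b + s%:C%C * ev2 g a b) <= s * normc (ev2 g a0 b0).
    have -> : s * normc (ev2 g a0 b0) = normc (ev2 (f + s%:C%C *: g) a0 b0).
      by rewrite evD f0 add0r normcM normc_real gtr0_norm.
    apply: le_trans h1; rewrite /K -mulrA ler_wpM2l ?exprn_ge0 ?divr_ge0 ?subr_ge0 ?(ltW aD) //.
    by rewrite -evD.
  have h4 : normc (ev2 f a b) <= normc (ev2 f a b + s%:C%C * ev2 g a b) + s * normc (ev2 g a b).
    rewrite -{1}(addrK (s%:C%C * ev2 g a b) (ev2 f a b)) (le_trans (normcB _ _)) //.
    by rewrite normcM normc_real gtr0_norm.
  rewrite -(ler_pM2l K0) in h4; clear -h3 h4; clearbody K; lra.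
apply: eq_ev2 => a b; rewrite [RHS]/ev2 meval0.
apply: (poly_fun_eq0 (ev2_poly_fun_l b df)) => a' a'D.
by apply: (poly_fun_eq0 (ev2_poly_fun_r a' df)) => b' b'D; exact: fD.
Qed.

(** On the slices at [(1 - t) b] the Harnack inequality compares the values at [a] and at 1 with a
    constant independent of [t], so the zero moves to [(1, b)] as [t] tends to 0. Keeping [F]
    abstract allows exchanging the variables. *)
Lemma hurwitz_boundary d (F : R[i] -> R[i] -> R[i]) a b :
  (forall b, poly_fun d (F^~ b)) ->
  (forall x, exists C : R, forall t, 0 < t -> t <= 1 ->
     normc (F x (b + - (t%:C%C * b)) - F x b) <= C * t) ->
  (forall x y, inD x -> inD y -> F x y != 0) ->
  inD a -> inT b -> F a b = 0 -> F 1 b = 0.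
Proof.
move=> Fd Fc F0 aD bT Fab; apply/eqP; rewrite -normc_eq0 eq_le normc_ge0 andbT.
pose K := ((1 - normc a) / 2) ^+ d.
have K0 : 0 < K by rewrite exprn_gt0 ?divr_gt0 ?subr_gt0.
have [Ca hCa] := Fc a; have [C1 hC1] := Fc 1.
rewrite -(pmulr_rle0 _ K0); apply: (@le0_of_linear_bound _ _ (Ca + K * C1)) => t t0 t1.
set b' := b + - (t%:C%C * b).
have b'D : inD b' by rewrite /inD normc_shrink // ltrBlDr ltrDl.
have oneD : inDbar (1 : R[i]) by rewrite /inDbar normc1.
have h1 := poly_fun_harnack (Fd b') (fun z zD => F0 z b' zD b'D) aD oneD.
have := hCa t t0 t1; rewrite Fab subr0 -/b' => h2.
have h3 := normcBr (F 1 b) (F 1 b'); rewrite normc_distC in h3.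
have := le_trans h3 (hC1 t t0 t1); rewrite -(ler_pM2l K0) => h4.
rewrite -/K in h1; clear -h1 h2 h4; clearbody K; lra.
Qed.

Lemma ev2_nonvanishing_closed q :
  (forall a b, inD a -> inD b -> ev2 q a b != 0) ->
  (forall a b, inT a -> inT b -> ev2 q a b != 0) ->
  forall a b, inDbar a -> inDbar b -> ev2 q a b != 0.
Proof.
move=> qD qT.
have oneT : inT (1 : R[i]) by exact: normc1.
have step t (x : R[i]) : 0 < t -> t <= 1 -> inT x -> normc (x + - (t%:C%C * x) - x) <= t.
  by move=> t0 t1 xT; rewrite addrAC subrr add0r normcN normcM xT mulr1 normc_real gtr0_norm.
have qDT a b : inD a -> inT b -> ev2 q a b != 0.
  move=> aD bT; apply/eqP => q0; have /eqP := qT 1 b oneT bT; apply.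
  apply: (hurwitz_boundary (fun b => ev2_poly_fun_l b (leqnn _)) _ qD aD bT q0) => x.
  have [C [_ hC]] := ev2_lipschitz q x b; exists C => t t0 t1.
  by apply: hC => //; [rewrite subrr normc0 ltW|exact: step].
have qTD a b : inT a -> inD b -> ev2 q a b != 0.
  move=> aT bD; apply/eqP => q0; have /eqP := qT a 1 aT oneT; apply.
  apply: (@hurwitz_boundary _ (fun x y => ev2 q y x) b a (fun b => ev2_poly_fun_r b (leqnn _))
    _ (fun x y xD yD => qD y x yD xD) bD aT q0) => x.
  have [C [_ hC]] := ev2_lipschitz q a x; exists C => t t0 t1.
  by apply: hC => //; [exact: step|rewrite subrr normc0 ltW].
have split_closed x : inDbar x -> inD x \/ inT x.
  by rewrite /inDbar le_eqVlt => /orP[/eqP|]; [right|left].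
move=> a b /split_closed[aD|aT] /split_closed[bD|bT].
- exact: qD.
- exact: qDT.
- exact: qTD.
- exact: qT.
Qed.

Lemma ev2_ratio_continuous f g a b : ev2 g a b != 0 ->
  forall eps : R, 0 < eps -> exists2 del : R, 0 < del &
  forall x y, Num.max (normc (x - a)) (normc (y - b)) < del ->
    normc (ev2 f x y / ev2 g x y - ev2 f a b / ev2 g a b) < eps.
Proof.
move=> g0 e e0; set G := normc (ev2 g a b); have G0 : 0 < G by rewrite normc_gt0.
have [A [A0 hA]] := ev2_lipschitz f a b; have [B [B0 hB]] := ev2_lipschitz g a b.
pose Q := A * G + normc (ev2 f a b) * B.
have Q0 : 0 <= Q by rewrite addr_ge0 ?mulr_ge0 ?normc_ge0 // ltW.
have B1 : 0 < B + 1 by rewrite ltr_wpDl.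
have Q1 : 0 < Q + 1 by rewrite ltr_wpDl.
have G2 : 0 < G ^+ 2 / 2 by rewrite divr_gt0 ?exprn_gt0.
(* The second bound keeps [|g| >= G / 2] nearby; the third makes the numerator [M * Q] of the
   difference smaller than [e G^2 / 2]. *)
exists (Num.min 1 (Num.min (G / (2 * (B + 1))) (e * (G ^+ 2 / 2) / (Q + 1)))).
  by rewrite !lt_min ltr01 /=; apply/andP; split; apply: divr_gt0 => //; apply: mulr_gt0.
move=> x y; set M := Num.max _ _; rewrite !lt_min => /and3P[M1 MG MQ].
have [m1 m2] : normc (x - a) <= M /\ normc (y - b) <= M by rewrite !le_max !lexx !orbT.
have M0 : 0 <= M by apply: le_trans (normc_ge0 _) m1.
have {}hA := hA _ _ _ (ltW M1) m1 m2; have {}hB := hB _ _ _ (ltW M1) m1 m2.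
rewrite ltr_pdivlMr ?mulr_gt0 // in MG; rewrite ltr_pdivlMr // in MQ.
have low : G / 2 <= normc (ev2 g x y).
  have := normcBr (ev2 g a b) (ev2 g x y); rewrite normc_distC => h.
  have := le_trans h hB; rewrite -/G; clear -MG M0; move: (normc _) => v; clearbody G M; nra.
have gxy : ev2 g x y != 0 by rewrite -normc_gt0 (lt_le_trans _ low) // divr_gt0.
have -> : ev2 f x y / ev2 g x y - ev2 f a b / ev2 g a b =
    ((ev2 f x y - ev2 f a b) * ev2 g a b - ev2 f a b * (ev2 g x y - ev2 g a b))
    / (ev2 g x y * ev2 g a b).
  have aux (K : fieldType) (u v u' v' : K) : v != 0 -> v' != 0 ->
    u / v - u' / v' = ((u - u') * v' - u' * (v - v')) / (v * v').
    by move=> *; field; apply/andP.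
  exact: aux.
rewrite normcM normcV normcM ltr_pdivrMr ?mulr_gt0 ?normc_gt0 // -/G.
have num : normc ((ev2 f x y - ev2 f a b) * ev2 g a b - ev2 f a b * (ev2 g x y - ev2 g a b))
    <= M * Q.
  rewrite (le_trans (normcB _ _)) // !normcM -/G /Q mulrDr lerD //.
    by rewrite mulrA ler_pM2r // [M * A]mulrC.
  by rewrite mulrCA ler_wpM2l ?normc_ge0 // [M * B]mulrC.
apply: (le_lt_trans num); apply: (@lt_le_trans _ _ (e * (G ^+ 2 / 2))).
  by apply: le_lt_trans MQ; rewrite ler_wpM2l // lerDl.
by rewrite ler_pM2l // expr2 mulrAC ler_pM2r.
Qed.

End Hurwitz.

(** * Rational inner functions of degree (m, n, 1) *)

(** The Cayley images [(1 + i k) / (1 - i k)] of the naturals are distinct and unimodular. *)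
Lemma torus_infinite (R : rcfType) (s : seq R[i]) : exists2 c, inT c & c \notin s.
Proof.
pose r (k : nat) : R[i] := (1 +i* k%:R)%C / (1 +i* - k%:R)%C.
have den (k : nat) : (1 +i* - k%:R)%C != 0 :> R[i] by rewrite eq_complex /= oner_eq0.
have rT k : inT (r k).
  have -> : r k = (1 +i* k%:R)%C / Num.conj (1 +i* k%:R)%C by [].
  rewrite /inT normcM normcV normc_conj divff // normc_eq0.
  by rewrite eq_complex /= oner_eq0.
have r_inj : injective r.
  move=> i j /eqP; rewrite /r eqr_div // => /eqP [] _ h.
  by apply/eqP; rewrite -(@eqr_nat R); apply/eqP; lra.
pose l := [seq r k | k <- iota 0 (size s).+1].
have [/allP ls|] := boolP (all (mem s) l).
  have : uniq l by rewrite map_inj_uniq // iota_uniq.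
  by move=> /uniq_leq_size/(_ ls); rewrite size_map size_iota ltnn.
by move=> /allPn[_ /mapP[k _ ->]] ns; exists (r k).
Qed.

Section RationalInner.
Variable R : rcfType.
Variables (m n : nat) (p : {mpoly R[i][3]}) (p1 p2 : {mpoly R[i][2]}) (lam : R[i]).
Hypothesis p_neq0 : forall a b c, inD a -> inD b -> inD c -> ev3 p a b c != 0.
Hypothesis p_le : {in msupp p, forall mo, (mo <= mnm3 m n)%MM}.
Hypothesis pE : forall a b c, ev3 p a b c = ev2 p1 a b + c * ev2 p2 a b.
Hypothesis lamT : inT lam.

Let q := lam *: p1 - mrefl (mnm2 m n) p2.
Let qt := mrefl (mnm2 m n) q.
Let N := ptilde m n p - lam *: p.

Lemma qE a b : ev2 q a b = lam * ev2 p1 a b - ev2 (mrefl (mnm2 m n) p2) a b.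
Proof. by rewrite /ev2 mevalB mevalZ. Qed.

Lemma qtE a b : lam * ev2 qt a b = ev2 (mrefl (mnm2 m n) p1) a b - lam * ev2 p2 a b.
Proof.
have -> : qt = Num.conj lam *: mrefl (mnm2 m n) p1 - p2.
  rewrite /qt /q -scaleN1r mreflD !mreflZ (mrefl_slope_part p_le pE).
  by rewrite rmorphN1 scaleN1r.
by rewrite {1}/ev2 mevalB mevalZ mulrBr mulrA [lam * Num.conj lam]mulrC conj_inT // mul1r.
Qed.

Lemma ev3N a b c : ev3 N a b c = ev3 (ptilde m n p) a b c - lam * ev3 p a b c.
Proof. by rewrite {1}/ev3 mevalB mevalZ. Qed.

Lemma ev3N_affine a b c : ev3 N a b c = - ev2 q a b + c * (lam * ev2 qt a b).
Proof.
rewrite ev3N (ev3_ptilde p_le pE) pE qE qtE.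
have aux (K : comNzRingType) (x y z u v w : K) :
  x * y + z - v * (u + x * w) = - (v * u - z) + x * (y - v * w) by ring.
exact: aux.
Qed.

Lemma ev3N_torus a b c : inT a -> inT b -> inT c -> ev3 p a b c = 0 -> ev3 N a b c = 0.
Proof.
move=> aT bT cT p0; rewrite ev3N (ev3_ptilde_torus p_le) // p0 rmorph0 !mulr0.
by rewrite subrr.
Qed.

Lemma singularity_of_nt_limit t1 t2 t3 : inT t1 -> inT t2 -> inT t3 ->
  ev3 p t1 t2 t3 = 0 -> nt_limit m n p t1 t2 t3 lam ->
  ev2 q t1 t2 = 0 /\ lam * ev2 qt t1 t2 = 0.
Proof.
move=> T1 T2 T3 p0 nt; have N0 := ev3N_torus T1 T2 T3 p0.
have [D1 [D2 [C hN]]] := first_order_affine t1 t2 t3 ev3N_affine.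
have ann := nt_limit_annihilates p_neq0 T1 T2 T3 p0 N0 hN nt.
(* Subtracting the relations for [r = 1] and [r = 2] isolates the third derivative; 2 is written
   [1 + 1] so that the embedding of the reals splits it. *)
have e1 := ann 1 (lexx _) (ler1n _ 2); have e2 := ann (1 + 1) (ler1n _ 2) (lexx _).
have qt0 : lam * ev2 qt t1 t2 = 0.
  have : lam * ev2 qt t1 t2 * t3 = 0.
    rewrite rmorphD rmorph1 in e2; rewrite rmorph1 in e1.
    have aux (K : comNzRingType) (x d t : K) :
      x + d * (1 * t) = 0 -> x + d * ((1 + 1) * t) = 0 -> d * t = 0.
      move=> h1 h2; have -> : d * t = x + d * ((1 + 1) * t) - (x + d * (1 * t)) by ring.
      by rewrite h1 h2 subrr.
    exact: aux e1 e2.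
  by move/eqP; rewrite mulf_eq0 (negPf (inT_neq0 T3)) orbF => /eqP.
split=> //; apply/eqP; rewrite -oppr_eq0; apply/eqP.
by rewrite -N0 ev3N_affine qt0 mulr0 addr0.
Qed.

(** * Domination by p and the zeros of q *)

Lemma ptilde_le a b c : inD a -> inD b -> inD c ->
  normc (ev3 (ptilde m n p) a b c) <= normc (ev3 p a b c).
Proof.
move=> aD bD cD; apply: mrefl_le => [//|u uD|]; last by case=> [[|[|[|]]]].
by rewrite meval_ev3 p_neq0.
Qed.

Lemma p1_neq0 a b : inD a -> inD b -> ev2 p1 a b != 0.
Proof.
move=> aD bD; have D0 : inD (0 : R[i]) by rewrite /inD normc0.
by have := p_neq0 aD bD D0; rewrite pE mul0r addr0.
Qed.

(** Otherwise [- p1 / p2] would be a root of [p] in the open disc. *)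
Lemma p2_le_p1 a b : inD a -> inD b -> normc (ev2 p2 a b) <= normc (ev2 p1 a b).
Proof.
move=> aD bD; rewrite leNgt; apply/negP => lt12.
have p20 : ev2 p2 a b != 0 by rewrite -normc_gt0 (le_lt_trans (normc_ge0 _) lt12).
have cD : inD (- (ev2 p1 a b / ev2 p2 a b)).
  by rewrite /inD normcN normcM normcV ltr_pdivrMr ?normc_gt0 // mul1r.
by have := p_neq0 aD bD cD; rewrite pE mulNr divfK // subrr eqxx.
Qed.

Lemma p_lower_bound a b c : inD a -> inD b -> inD c ->
  normc (ev2 p2 a b) * (1 - normc c) <= normc (ev3 p a b c).
Proof.
move=> aD bD cD; rewrite pE -[c * _]opprK; apply: le_trans (normcBr _ _).
by rewrite normcN normcM mulrBr mulr1 [normc c * _]mulrC lerD2r p2_le_p1.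
Qed.

(** The perturbation [q + s lam p1 = (1 + s) lam p1 - p2~] has no zero in the bidisk, because
    [|p2~| <= |p1|] and [p1] is zero free there. *)
Lemma q_neq0_or_eq0 : q = 0 \/ forall a b, inD a -> inD b -> ev2 q a b != 0.
Proof.
have [q0|q0] := eqVneq q 0; [by left|right=> a b aD bD].
apply/eqP => qab; move/eqP: q0; apply.
apply: (hurwitz_bidisk (g := lam *: p1) _ aD bD qab) => s s0 s1 x y xD yD.
have D0 : inD (0 : R[i]) by rewrite /inD normc0.
have := ptilde_le xD yD D0; rewrite (ev3_ptilde p_le pE) pE !mul0r add0r addr0 => le21.
have -> : ev2 (q + s%:C%C *: (lam *: p1)) x y =
    (1 + s)%:C%C * (lam * ev2 p1 x y) - ev2 (mrefl (mnm2 m n) p2) x y.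
  by rewrite {1}/ev2 mevalD !mevalZ -/(ev2 _ _ _) qE rmorphD rmorph1 mulrDl mul1r addrAC.
rewrite subr_eq0; apply/eqP => /(congr1 (@normc R)).
rewrite !normcM lamT mul1r normc_real gtr0_norm ?addr_gt0 // => h.
move: le21; rewrite -h leNgt; apply/negP; rewrite negbK.
by rewrite ltr_pMl ?normc_gt0 ?p1_neq0 // ltrDl.
Qed.

Lemma ptilde_eq_of_q_eq0 : q = 0 -> ptilde m n p = lam *: p.
Proof.
move=> q0; apply/eqP; rewrite -subr_eq0; apply/eqP/eq_ev3 => a b c.
rewrite -/N ev3N_affine /qt q0 mrefl0 /ev2 /ev3 !meval0.
by rewrite !mulr0 oppr0 addr0.
Qed.

(** Adding the torus identity for [p] at third coordinates 1 and -1 cancels [p1] and leaves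
    [p2~ = a^m b^n conj p2]. *)
Lemma mrefl_p2_torus a b : inT a -> inT b ->
  normc (ev2 (mrefl (mnm2 m n) p2) a b) = normc (ev2 p2 a b).
Proof.
move=> aT bT; have oneT : inT (1 : R[i]) by exact: normc1.
have NoneT : inT (-1 : R[i]) by rewrite /inT normcN normc1.
have h1 := ev3_ptilde_torus p_le aT bT oneT; have h2 := ev3_ptilde_torus p_le aT bT NoneT.
rewrite !(ev3_ptilde p_le pE) !pE !mul1r !mulN1r !mulr1 !mulrN1 !mulNr in h1 h2.
have : 2 * ev2 (mrefl (mnm2 m n) p2) a b =
    2 * (a ^+ m * b ^+ n * Num.conj (ev2 p2 a b)).
  rewrite rmorphD rmorphB /= in h1 h2.
  have aux (K : comNzRingType) (u v x y w : K) : u + v = w * (x + y) ->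
      - u + v = - (w * (x - y)) -> 2 * v = 2 * (w * y).
    move=> e1 e2; have -> : 2 * v = (u + v) + (- u + v) by ring.
    by rewrite e1 e2; ring.
  exact: aux h1 h2.
move/mulfI; rewrite pnatr_eq0 => /(_ isT) ->.
by rewrite !normcM !normcX aT bT !expr1n !mul1r normc_conj.
Qed.

(** The third derivative of [N] vanishes because [N] and [q] do, the other two by contraction.
    Nonvanishing of [p2] serves twice: as the coefficient [E3] in the contraction and as the lower
    bound for [p]. *)
Lemma nt_limit_of_q_zero t1 t2 t3 : inT t1 -> inT t2 -> inT t3 ->
  ev2 p2 t1 t2 != 0 -> ev3 p t1 t2 t3 = 0 -> ev2 q t1 t2 = 0 ->
  nt_limit m n p t1 t2 t3 lam.
Proof.
move=> T1 T2 T3 p20 p0 q0; have N0 := ev3N_torus T1 T2 T3 p0.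
have qt0 : lam * ev2 qt t1 t2 = 0.
  have := N0; rewrite ev3N_affine q0 oppr0 add0r => /eqP.
  by rewrite mulf_eq0 (negPf (inT_neq0 T3)) => /eqP.
have [D1 [D2 [C hN]]] := first_order_affine t1 t2 t3 ev3N_affine.
have [E1 [E2 [C' hp]]] := first_order_affine t1 t2 t3 pE.
rewrite qt0 in hN.
have dom a b c : inD a -> inD b -> inD c ->
    normc (ev3 N a b c + lam * ev3 p a b c) <= normc (ev3 p a b c).
  by move=> aD bD cD; rewrite ev3N subrK ptilde_le.
have ctr := tangent_contraction dom lamT T1 T2 T3 N0 p0 hN hp.
have E30 : ev2 p2 t1 t2 * t3 != 0 by rewrite mulf_neq0 // inT_neq0.
have D10 : D1 * t1 = 0.
  apply: (contraction_coef_eq0 lamT E30) => w1 w2 w3 r1 r2 r3.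
  by have := ctr w1 w2 w3 r1 r2 r3; rewrite !mul0r addr0; exact.
have D20 : D2 * t2 = 0.
  apply: (contraction_coef_eq0 lamT E30) => w1 w2 w3 r1 r2 r3.
  have := ctr w2 w1 w3 r2 r1 r3; rewrite !mul0r addr0.
  by rewrite [D1 * _ * _ + _]addrC [E1 * _ * _ + _]addrC; exact.
move/eqP: D10; move/eqP: D20; rewrite !mulf_eq0 (negPf (inT_neq0 T1)) (negPf (inT_neq0 T2)) !orbF.
move=> /eqP D20 /eqP D10; rewrite D10 D20 in hN.
have [L [L0 hL]] := ev2_lipschitz p2 t1 t2.
(* Half of [|p2|] at the point persists within radius [kappa / (L + 1)] by the Lipschitz bound. *)
pose kappa := normc (ev2 p2 t1 t2) / 2.
have k0 : 0 < kappa by rewrite divr_gt0 // normc_gt0.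
have L1 : 0 < L + 1 by rewrite ltr_wpDl.
apply: (nt_limit_of_flat (kappa := kappa) (r := Num.min 1 (kappa / (L + 1))) p_neq0 N0 hN k0).
  by rewrite lt_min ltr01 divr_gt0.
move=> a b c aD bD cD; rewrite !lt_min => /andP[a1 ar] /andP[b1 br].
apply: le_trans (p_lower_bound aD bD cD); rewrite ler_wpM2r ?subr_ge0 ?(ltW cD) //.
pose M := Num.max (normc (a - t1)) (normc (b - t2)).
have M1 : M <= 1 by rewrite ge_max !ltW.
have Mk : M * (L + 1) <= kappa by rewrite -ler_pdivlMr // ge_max !ltW.
have M0 : 0 <= M by rewrite le_max normc_ge0.
have := hL a b M M1; rewrite !le_max !lexx orbT => /(_ isT isT) h.
have := normcBr (ev2 p2 t1 t2) (ev2 p2 a b); rewrite normc_distC => h'.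
have {h h'} := le_trans h' h.
have -> : normc (ev2 p2 t1 t2) = 2 * kappa by rewrite /kappa mulrC divfK // pnatr_eq0.
by move: (normc _) => v; clearbody M kappa; lra.
Qed.

Lemma q_neq0_torus (s : seq (R[i] * R[i] * R[i])) :
  (forall a b c, inT a -> inT b -> inT c -> ev3 p a b c = 0 -> (a, b, c) \in s) ->
  ~ (exists t1 t2 t3, [/\ inT t1, inT t2, inT t3, ev3 p t1 t2 t3 = 0 &
       nt_limit m n p t1 t2 t3 lam]) ->
  forall a b, inT a -> inT b -> ev2 q a b != 0.
Proof.
move=> fin nolim a b aT bT; apply/eqP => q0.
have n12 : normc (ev2 p1 a b) = normc (ev2 p2 a b).
  move/eqP: q0; rewrite qE subr_eq0 => /eqP/(congr1 (@normc R)).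
  by rewrite normcM lamT mul1r mrefl_p2_torus.
(* If [p2] vanishes, so does [p1], and [p] vanishes on a whole circle above [(a, b)], against
   finiteness. Otherwise the root [- p1 / p2] is unimodular. *)
have [p20|p20] := eqVneq (ev2 p2 a b) 0.
  have p10 : ev2 p1 a b = 0 by apply/eqP; rewrite -normc_eq0 n12 p20 normc0.
  have [c cT] := torus_infinite [seq x.2 | x <- s].
  move/negP; apply; apply/mapP; exists (a, b, c) => //.
  by apply: fin => //; rewrite pE p10 p20 mulr0 addr0.
apply: nolim; exists a, b, (- (ev2 p1 a b / ev2 p2 a b)).
have cT : inT (- (ev2 p1 a b / ev2 p2 a b)).
  by rewrite /inT normcN normcM normcV n12 divff // normc_eq0.
have p0 : ev3 p a b (- (ev2 p1 a b / ev2 p2 a b)) = 0 by rewrite pE mulNr divfK // subrr.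
by split=> //; exact: nt_limit_of_q_zero.
Qed.

End RationalInner.

Theorem theorem4p8 (R : realType) (m n : nat)
  (p : {mpoly R[i][3]}) (p1 p2 : {mpoly R[i][2]}) (lam : R[i]) :
  RIF3_deg m n p ->
  mirreducible p ->
  (forall a b c : R[i], ev3 p a b c = ev2 p1 a b + c * ev2 p2 a b) ->
  (exists s : seq (R[i] * R[i] * R[i]), forall a b c : R[i],
      inT a -> inT b -> inT c -> ev3 p a b c = 0 -> (a, b, c) \in s) ->
  inT lam ->
  let q := lam *: p1 - mrefl (mnm2 m n) p2 in
  let qt := mrefl (mnm2 m n) q in
  (forall t1 t2 t3 : R[i], inT t1 -> inT t2 -> inT t3 -> ev3 p t1 t2 t3 = 0 ->
     nt_limit m n p t1 t2 t3 lam ->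
     ev2 q t1 t2 = 0 /\ lam * ev2 qt t1 t2 = 0) /\
  (~ (exists t1 t2 t3 : R[i], [/\ inT t1, inT t2, inT t3, ev3 p t1 t2 t3 = 0 &
       nt_limit m n p t1 t2 t3 lam]) ->
     exists f : R[i] -> R[i] -> R[i], cont_on_closed_bidisk f /\
       forall a b : R[i], inDbar a -> inDbar b -> ev2 q a b != 0 ->
         f a b = lam * ev2 qt a b / ev2 q a b).
Proof.
move=> [_ pD ncf pdeg _] [pnc _] pE [s fin] lamT q qt.
have p_le := msupp_le_mnm3 pdeg.
split=> [t1 t2 t3 T1 T2 T3|nolim]; first exact: singularity_of_nt_limit.
have qT := q_neq0_torus pD p_le pE lamT fin nolim.
have qD : forall a b, inD a -> inD b -> ev2 q a b != 0.
  (* If [q = 0] then [p] divides its reflection, so [p] is a common factor, hence constant, contrary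
     to irreducibility. *)
  have [q0|//] := q_neq0_or_eq0 pD p_le pE lamT; case: pnc; apply: ncf.
    by exists 1; rewrite mulr1.
  by exists lam%:MP; rewrite (ptilde_eq_of_q_eq0 p_le pE lamT q0) mulrC mul_mpolyC.
have qC := ev2_nonvanishing_closed qD qT.
exists (fun a b => lam * ev2 qt a b / ev2 q a b); split=> // a b aC bC e e0.
have [del d0 hd] := ev2_ratio_continuous (lam *: qt) (qC a b aC bC) e0.
exists del => // x y _ _ /hd.
by rewrite {1 3}/ev2 !mevalZ.
Qed.
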